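(* Let $A$ be a Noetherian local ring and let $\mathfrak{F}=(I_n)_{n\ge0}$ be a good filtration of $A$. Then $$\operatorname{reg} R(\mathfrak{F})=\operatorname{reg} G(\mathfrak{F}).$$
   Context: Rings are commutative. A filtration of $A$ is a sequence $\mathfrak{F}=(I_n)_{n\ge0}$ of ideals with $I_0=A\supset I_1\supseteq I_2\supseteq\cdots$, $I_1\ne A$ and $I_iI_j\subseteq I_{i+j}$ for all $i,j\ge 0$. It is a good filtration if there is an ideal $I$ of $A$ with $I I_i\subseteq I_{i+1}$ for all $i\ge 0$ and $I_{n+1}=I I_n$ for all $n\gg 0$. The Rees algebra is $R(\mathfrak{F})=\bigoplus_{n\ge 0} I_nt^n$ and the associated graded ring is $G(\mathfrak{F})=\bigoplus_{n\ge0} I_n/I_{n+1}$. For a nonnegatively graded ring $S$, $S_+$ is the ideal generated by the homogeneous elements of positive degree. For a graded $S$-module $M$ with homogeneous components $M_n$, $a(M)=\max\{n: M_n\ne 0\}$ if $M\neq 0$ and $a(M)=-\infty$ if $M=0$; $a_i(M)=a(H^i_{S_+}(M))$, where $H^i_{S_+}$ is the $i$-th (graded) local cohomology functor with respect to $S_+$. The Castelnuovo-Mumford regularity is $\operatorname{reg}(M)=\max\{a_i(M)+i: i\ge 0\}$. $\operatorname{reg} R(\mathfrak{F})$ and $\operatorname{reg} G(\mathfrak{F})$ are computed with $S=M=R(\mathfrak{F})$ and $S=M=G(\mathfrak{F})$ respectively (these rings need not be generated in degree one). *)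

(* Defs.v *)
From HB Require Import structures.
From mathcomp Require Import all_boot all_order all_algebra.
From mathcomp Require Import mathcomp_extra boolp classical_sets.
From mathcomp Require Import constructive_ereal.

Set Implicit Arguments.
Unset Strict Implicit.
Unset Printing Implicit Defensive.

Import Order.TTheory GRing.Theory Num.Theory.

Local Open Scope classical_set_scope.
Local Open Scope ring_scope.

(* Unlike [idealr_closed], this allows the improper ideal. *)
Definition is_ideal (A : comNzRingType) (I : set A) : Prop :=
  I 0 /\ forall a x y, I x -> I y -> I (a * x + y).

Definition ideal_span (A : comNzRingType) (X : set A) : set A :=
  smallest (@is_ideal A) X.

Definition ideal_mul (A : comNzRingType) (I J : set A) : set A :=
  ideal_span [set z | exists x y, [/\ I x, J y & z = x * y]].

Definition ideal_exp (A : comNzRingType) (I : set A) (k : nat) : set A :=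
  iter k (ideal_mul I) setT.

Definition noetherian (A : comNzRingType) : Prop :=
  forall I : set A, is_ideal I -> exists s : seq A, I = ideal_span [set` s].

Definition maximal_ideal (A : comNzRingType) (m : set A) : Prop :=
  [/\ is_ideal m, m <> setT
    & forall J : set A, is_ideal J -> m `<=` J -> J = m \/ J = setT].

Definition local_ring (A : comNzRingType) : Prop :=
  exists! m : set A, maximal_ideal m.

Record filtration (A : comNzRingType) := Filtration {
  filt :> nat -> set A;
  filt_ideal : forall n, is_ideal (filt n);
  filt0 : filt 0%N = setT;
  filt1 : filt 1%N <> setT;
  filtS : forall n, filt n.+1 `<=` filt n;
  filtM : forall i j, ideal_mul (filt i) (filt j) `<=` filt (i + j)%N
}.

Definition good_filtration (A : comNzRingType) (F : filtration A) : Prop :=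
  exists I : set A, [/\ is_ideal I,
    forall i, ideal_mul I (F i) `<=` F i.+1
    & exists N, forall n, (N <= n)%N -> F n.+1 = ideal_mul I (F n)].

(* V is the internal direct sum of the subgroups [P n], n in Z. *)
Definition is_grading (V : zmodType) (P : int -> set V) : Prop :=
  [/\ forall n, P n 0 /\ (forall x y, P n x -> P n y -> P n (x - y)),
      forall x, exists (s : seq int) (f : int -> V),
        (forall n, P n (f n)) /\ x = \sum_(n <- s) f n
    & forall (s : seq int) (f : int -> V), uniq s -> (forall n, P n (f n)) ->
        \sum_(n <- s) f n = 0 -> forall n, n \in s -> f n = 0].

(* Nonnegatively graded commutative rings; the pieces are indexed by int, the
   negative ones being zero, so that such a ring is a graded module over
   itself. *)
Record gradedRing := GradedRing {
  gr_ring :> comNzRingType;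
  gr_piece : int -> set gr_ring;
  gr_grading : is_grading gr_piece;
  gr_nonneg : forall n, n < 0 -> gr_piece n = [set 0];
  gr_one : gr_piece 0 1;
  gr_mul : forall m n x y,
    gr_piece m x -> gr_piece n y -> gr_piece (m + n) (x * y)
}.

Record gradedModule (S : gradedRing) := GradedModule {
  gm_mod :> lmodType S;
  gm_piece : int -> set gm_mod;
  gm_grading : is_grading gm_piece;
  gm_scale : forall m n (a : S) x,
    gr_piece m a -> gm_piece n x -> gm_piece (m + n) (a *: x)
}.

Definition graded_map (S : gradedRing) (M N : gradedModule S) (f : M -> N) :=
  forall n x, gm_piece n x -> gm_piece n (f x).

Definition self_module (S : gradedRing) : gradedModule S :=
  @GradedModule S S^o (@gr_piece S) (gr_grading S) (@gr_mul S).

(* S_+ *)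
Definition irrelevant_ideal (S : gradedRing) : set S :=
  ideal_span [set x | exists2 n, 0 < n & gr_piece n x].
Arguments irrelevant_ideal S _ : clear implicits.

(* Injective objects of the category of graded S-modules and degree-preserving
   S-linear maps. *)
Definition graded_injective (S : gradedRing) (E : gradedModule S) : Prop :=
  forall (M N : gradedModule S) (f : {linear M -> N}) (g : {linear M -> E}),
    graded_map f -> injective f -> graded_map g ->
    exists h : {linear N -> E}, graded_map h /\ forall x, h (f x) = g x.

Record graded_injective_resolution (S : gradedRing) (M : gradedModule S) :=
  GradedInjectiveResolution {
  res_obj :> nat -> gradedModule S;
  res_aug : {linear M -> res_obj 0%N};
  res_d : forall i, {linear res_obj i -> res_obj i.+1};
  res_inj : forall i, graded_injective (res_obj i);
  res_aug_graded : graded_map res_aug;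
  res_d_graded : forall i, graded_map (res_d i);
  res_aug_inj : injective res_aug;
  res_exact0 : range res_aug = [set x | res_d 0%N x = 0];
  res_exact : forall i, range (res_d i) = [set x | res_d i.+1 x = 0]
}.

(* The torsion functor M |-> {x in M | (S_+)^k x = 0 for some k}, whose right
   derived functors are the local cohomology functors. *)
Definition torsion (S : gradedRing) (M : gradedModule S) : set M :=
  [set x | exists k, forall a, ideal_exp (irrelevant_ideal S) k a ->
     a *: x = 0].

Section Regularity.
Variables (S : gradedRing) (M : gradedModule S).
Variable E : graded_injective_resolution M.

Definition lc_cocycle (i : nat) (n : int) : set (E i) :=
  [set x | [/\ torsion x, gm_piece n x & res_d E i x = 0]].
Arguments lc_cocycle i n _ : clear implicits.

Definition lc_coboundary (i : nat) (n : int) : set (E i) :=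
  match i return set (E i) with
  | 0%N => [set 0]
  | j.+1 => [set res_d E j y | y in [set y | torsion y /\ gm_piece n y]]
  end.
Arguments lc_coboundary i n _ : clear implicits.

(* The degree-n component of the i-th local cohomology module of M, computed
   as lc_cocycle i n / lc_coboundary i n, is nonzero. *)
Definition lc_nonzero (i : nat) (n : int) : Prop :=
  ~ (lc_cocycle i n `<=` lc_coboundary i n).

(* Maxima are taken as suprema in Z with -oo and +oo adjoined: the supremum of
   the empty set is -oo, and +oo only occurs when there is no maximum. *)
Definition a_inv (i : nat) : \bar int :=
  supremum -oo%E [set n%:E | n in [set n | lc_nonzero i n]].

Definition reg : \bar int :=
  supremum -oo%E [set (a_inv i + (i%:Z)%:E)%E | i in [set: nat]].

End Regularity.
Arguments lc_cocycle {S M} E i n _.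
Arguments lc_coboundary {S M} E i n _.

Section IdealTheory.
Variables (A : comNzRingType) (I : set A).
Hypothesis idI : is_ideal I.

Lemma is_ideal0 : I 0. Proof. by case: idI. Qed.

Lemma is_idealD x y : I x -> I y -> I (x + y).
Proof. by move=> Ix Iy; rewrite -[x]mul1r; apply: idI.2. Qed.

Lemma is_idealM a x : I x -> I (a * x).
Proof. by move=> Ix; rewrite -[_ * _]addr0; apply: idI.2 => //; case: idI. Qed.

Lemma is_idealB x y : I x -> I y -> I (x - y).
Proof. by move=> Ix Iy; apply: is_idealD => //; rewrite -mulN1r; apply: is_idealM. Qed.

Lemma is_ideal_sum (T : Type) (r : seq T) (P : pred T) (f : T -> A) :
  (forall t, P t -> I (f t)) -> I (\sum_(t <- r | P t) f t).
Proof.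
move=> If; elim/big_ind: _ => //; first exact: is_ideal0.
by move=> x y; apply: is_idealD.
Qed.

End IdealTheory.

Section Rees.
Variables (A : comNzRingType) (F : filtration A).

Lemma filtM_elt i j x y : F i x -> F j y -> F (i + j)%N (x * y).
Proof.
by move=> Fx Fy; apply: filtM => J [_]; apply; exists x, y.
Qed.

(* R(F) is the subring of A[t] of the polynomials whose coefficient of t^n is
   in I_n. *)
Definition rees_pred : {pred {poly A}} :=
  fun p => `[< forall n, F n p`_n >].

Lemma rees_predP (p : {poly A}) :
  reflect (forall n, F n p`_n) (p \in rees_pred).
Proof. exact: asboolP. Qed.

Lemma rees_subring_closed : subring_closed rees_pred.
Proof.
split.
- apply/rees_predP => -[|n]; rewrite coef1 ?filt0 //=.
  exact: is_ideal0 (filt_ideal F n.+1).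
- move=> p q /rees_predP Fp /rees_predP Fq; apply/rees_predP => n.
  by rewrite coefB; apply: (is_idealB (filt_ideal F n)).
- move=> p q /rees_predP Fp /rees_predP Fq; apply/rees_predP => n.
  rewrite coefM; apply: (is_ideal_sum (filt_ideal F n)) => i _.
  have {1}-> : n = (i + (n - i))%N by rewrite subnKC // -ltnS.
  exact: filtM_elt.
Qed.

HB.instance Definition _ :=
  GRing.isSubringClosed.Build {poly A} rees_pred rees_subring_closed.

Record rees_type := Rees { rees_val :> {poly A}; _ : rees_val \in rees_pred }.

HB.instance Definition _ := [isSub for rees_val].
HB.instance Definition _ := [Choice of rees_type by <:].
HB.instance Definition _ := [SubChoice_isSubComNzRing of rees_type by <:].

(* I_n t^n, and 0 for n < 0 *)
Definition rees_piece (n : int) : set rees_type :=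
  [set p : rees_type | forall k : nat, k%:Z != n -> (val p)`_k = 0].

Lemma rees_grading : is_grading rees_piece.
Proof.
split.
- move=> n; split=> [k _|x y Px Py k kn]; first by rewrite rmorph0 coef0.
  by rewrite rmorphB coefB Px // Py // subrr.
- move=> p.
  have Fp n : ((val p)`_n *: 'X^n) \in rees_pred.
    apply/rees_predP => k; rewrite coefZ coefXn.
    case: eqP => [->|_]; last first.
      by rewrite mulr0; apply: is_ideal0 (filt_ideal F k).
    by rewrite mulr1; apply/rees_predP: n; case: (p).
  exists [seq n%:Z | n <- iota 0 (size (val p))].
  exists (fun z => if z is Posz n then Rees (Fp n) else 0); split.
    case=> n k kn /=; last by rewrite coef0.
    have /negPf kn' : k != n by apply: contra_neq kn => ->.
    by rewrite coefZ coefXn kn' mulr0.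
  apply: val_inj; rewrite big_map rmorph_sum /=.
  by rewrite -{1}[rees_val p]coefK poly_def -(big_mkord xpredT (fun n : nat =>
     (rees_val p)`_n *: 'X^n)) /index_iota subn0.
- move=> s f us Pf /(congr1 val); rewrite rmorph_sum rmorph0 => s0 n ns.
  apply: val_inj; apply/polyP => k; rewrite rmorph0 coef0.
  have [kn|kn] := eqVneq k%:Z n; last exact: Pf.
  move/(congr1 (fun q : {poly A} => q`_k)): s0.
  rewrite coef_sum coef0 (bigD1_seq n) //= big1 ?addr0 // => m mn.
  by apply: Pf; rewrite kn eq_sym.
Qed.

Lemma rees_nonneg n : n < 0 -> rees_piece n = [set 0].
Proof.
move=> n0; apply/seteqP; split=> [p Pp|_ -> k _]; last by rewrite rmorph0 coef0.
apply: val_inj; apply/polyP => k; rewrite rmorph0 coef0; apply: Pp.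
by apply: contraTneq n0 => <-.
Qed.

Lemma rees_one : rees_piece 0 1.
Proof. by case=> // k _; rewrite rmorph1 coef1. Qed.

Lemma rees_mul m n x y :
  rees_piece m x -> rees_piece n y -> rees_piece (m + n) (x * y).
Proof.
move=> Px Py k kmn; rewrite rmorphM coefM big1 // => i _.
have [im|im] := eqVneq i%:Z m; last by rewrite Px ?mul0r.
rewrite Py ?mulr0 //; apply: contra_neq kmn => <-; rewrite -im -PoszD.
by rewrite subnKC // -ltnS.
Qed.

Definition rees : gradedRing :=
  GradedRing rees_grading rees_nonneg rees_one rees_mul.

(* The homogeneous ideal (+)_n I_{n+1} t^n of the Rees algebra; the quotient is
   (+)_n I_n / I_{n+1} with the multiplication induced by that of A. *)
Definition assoc_ideal : {pred rees_type} :=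
  fun p => `[< forall n, F n.+1 (val p)`_n >].

Lemma assoc_idealP (p : rees_type) :
  reflect (forall n, F n.+1 (val p)`_n) (p \in assoc_ideal).
Proof. exact: asboolP. Qed.

Lemma assoc_ideal_closed : idealr_closed assoc_ideal.
Proof.
split.
- apply/assoc_idealP => n; rewrite rmorph0 coef0.
  exact: is_ideal0 (filt_ideal F n.+1).
- apply/negP => /assoc_idealP/(_ 0%N); rewrite rmorph1 coef1 /= => F11.
  apply: (@filt1 _ F); apply/seteqP; split=> // x _; rewrite -[x]mulr1.
  exact: (is_idealM (filt_ideal F 1)).
- move=> a x y /assoc_idealP Jx /assoc_idealP Jy; apply/assoc_idealP => n.
  rewrite rmorphD rmorphM coefD.
  apply: (is_idealD (filt_ideal F n.+1)) => //.
  rewrite coefM; apply: (is_ideal_sum (filt_ideal F n.+1)) => i _.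
  have {1}-> : n.+1 = (i + (n - i).+1)%N by rewrite addnS subnKC // -ltnS.
  by apply: filtM_elt => //; apply/rees_predP; case: (a).
Qed.

HB.instance Definition _ :=
  isIdealr.Build rees_type assoc_ideal assoc_ideal_closed.

Definition assoc_type : comNzRingType := {ideal_quot assoc_ideal}.

Definition assoc_pi (p : rees_type) : assoc_type :=
  (\pi_({ideal_quot assoc_ideal}) p)%qT.

Lemma assoc_pi0 : assoc_pi 0 = 0.
Proof. exact: rmorph0. Qed.

Lemma assoc_piB : {morph assoc_pi : x y / x - y}.
Proof. exact: rmorphB. Qed.

Lemma assoc_pi1 : assoc_pi 1 = 1.
Proof. exact: rmorph1. Qed.

Lemma assoc_piM : {morph assoc_pi : x y / x * y}.
Proof. exact: rmorphM. Qed.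

Lemma assoc_pi_sum (T : Type) (r : seq T) (f : T -> rees_type) :
  assoc_pi (\sum_(t <- r) f t) = \sum_(t <- r) assoc_pi (f t).
Proof. exact: rmorph_sum. Qed.

Lemma assoc_pi_eq0 (p : rees_type) : assoc_pi p = 0 <-> p \in assoc_ideal.
Proof.
rewrite -assoc_pi0 -[p in p \in _]subr0 Quotient.idealrBE.
by split=> /eqP.
Qed.

Lemma assoc_pi_surj (x : assoc_type) : exists p, assoc_pi p = x.
Proof. by exists (repr x); apply: reprK. Qed.

(* I_n / I_{n+1}, and 0 for n < 0 *)
Definition assoc_piece (n : int) : set assoc_type :=
  [set assoc_pi p | p in rees_piece n].

Lemma assoc_grading : is_grading assoc_piece.
Proof.
have [sgR spanR _] := rees_grading; split.
- move=> n; split=> [|_ _ [p Pp <-] [q Pq <-]].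
    by exists 0; [exact: (sgR n).1|exact: assoc_pi0].
  by exists (p - q); [exact: (sgR n).2|exact: assoc_piB].
- move=> x; have [p <-] := assoc_pi_surj x.
  have [s [f [Pf ->]]] := spanR p.
  by exists s, (assoc_pi \o f); split=> [n|]; [exists (f n)|exact: assoc_pi_sum].
- move=> s f us Pf; have /choice[g Pg] : forall n, exists p, rees_piece n p /\ assoc_pi p = f n.
    by move=> n; have [p Pp fp] := Pf n; exists p.
  under eq_bigr do rewrite -(Pg _).2.
  rewrite -assoc_pi_sum => /assoc_pi_eq0/assoc_idealP Jg n ns.
  rewrite -(Pg n).2; apply/assoc_pi_eq0/assoc_idealP => k.
  have [kn|kn] := eqVneq k%:Z n; last first.
    by rewrite (Pg n).1 //; apply: is_ideal0 (filt_ideal F k.+1).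
  have := Jg k; rewrite rmorph_sum coef_sum (bigD1_seq n) //= big1 ?addr0 //.
  by move=> m mn; apply: (Pg m).1; rewrite kn eq_sym.
Qed.

Lemma assoc_nonneg n : n < 0 -> assoc_piece n = [set 0].
Proof. by move=> n0; rewrite /assoc_piece rees_nonneg // image_set1 assoc_pi0. Qed.

Lemma assoc_one : assoc_piece 0 1.
Proof. by exists 1; [exact: rees_one|exact: assoc_pi1]. Qed.

Lemma assoc_mul m n x y :
  assoc_piece m x -> assoc_piece n y -> assoc_piece (m + n) (x * y).
Proof.
move=> [p Pp <-] [q Pq <-]; exists (p * q); last exact: assoc_piM.
exact: rees_mul.
Qed.

Definition assoc_graded : gradedRing :=
  GradedRing assoc_grading assoc_nonneg assoc_one assoc_mul.

End Rees.

(* Main.v *)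
Require Import Defs.
From HB Require Import structures.
From mathcomp Require Import all_boot all_order all_algebra.
From mathcomp Require Import mathcomp_extra boolp classical_sets.
From mathcomp Require Import constructive_ereal.
From mathcomp Require Import zify.

Set Implicit Arguments.
Unset Strict Implicit.
Unset Printing Implicit Defensive.

Import Order.TTheory GRing.Theory Num.Theory.

Local Open Scope classical_set_scope.
Local Open Scope ring_scope.

(** Write R for the Rees algebra, G for the associated graded ring, R_+ for
the ideal of R of elements without constant term, and J for the kernel of
R -> G.  In degree n the ideal J is I_(n+1), which is R_+ in degree n+1, and
R/R_+ = A lives in degree 0.  The exact sequences 0 -> R_+ -> R -> A -> 0 and
0 -> J -> R -> G -> 0 therefore give

   H^i(R)_(n+1) -> H^i(R)_n -> H^i(G)_n -> H^(i+1)(R)_(n+1) -> H^(i+1)(R)_n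

as long as H^0(A) = A, the only nonzero cohomology of A, does not interfere.
If H^i(R)_n = 0 whenever n+i > c, the same follows for G.  Conversely, if
H^i(G)_n = 0 whenever n+i > c, then H^i(R)_(n+1) -> H^i(R)_n is onto in this
range; since H^i(R)_n = 0 for large n (Serre), descending induction on n
gives the vanishing for R.  The module A could only spoil the step i = 1,
n = -1, which occurs for c < 0 only.  But c is never negative: G is finitely
generated over a standard graded ring and G_n = 0 for n < 0, so the vanishing
of H^i(G)_n for all n+i >= 0 would make G_0 generated by G_(-1) = 0, against
I_1 <> A.

Local cohomology is made elementary as follows.  Generators y_0, ..., y_(r-1)
of the ideal I of a good filtration, placed in degree one, generate R_+ up to
radical.  So H^i(M)_n is the colimit, over the exponents e, of the degree n
part of the cohomology of the Koszul cochain complex of y_0^(e_0), ...,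
y_(r-1)^(e_(r-1)) on M.  What is needed of this colimit is when it vanishes,
for a subquotient L/N of a fixed module ([vanishes]); then long exact
sequences are chases of elements ([van_ext], [van_sub], [van_quo]), and R,
R_+, J and G may all be replaced by families of ideals of A itself
([van_rees], [van_rees_ideal], [van_assoc]).

The pieces are: the comparison with injective resolutions
([local_cohomology_koszul]), by dimension shifting from the acyclicity of
graded injective modules over a Noetherian ring ([injective_vanishes]); the
Noetherian property of R, from Hilbert's basis theorem ([rees_noetherian]);
Serre vanishing ([serre_vanishing]); the bound c >= 0
([regularity_nonneg]); and the two inequalities ([regularity_criteria]). *)

(** * Koszul complexes with varying exponents *)

Section Koszul.
Variable S : comNzRingType.
Implicit Types (V W : lmodType S) (y : nat -> S) (e : nat -> nat) (r f : nat).

(** The underlying module of the Koszul complex on r elements: the complex on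
r+1 elements is the mapping cone of multiplication by the last one, so that
its cochains are pairs of cochains on r elements. *)
Fixpoint koszul V r : lmodType S :=
  if r is r'.+1 then (koszul V r' * koszul V r')%type else V.

(** Multiplication is by [y j ^+ e j]: the exponents are a parameter because
local cohomology is the colimit over them. *)
Fixpoint kdiff V y e r : koszul V r -> koszul V r :=
  match r with
  | 0 => fun=> 0
  | r'.+1 => fun c => (kdiff y e c.1, y r' ^+ e r' *: c.1 - kdiff y e c.2)
  end.

(** The transition map of the direct system, from the exponents e to larger
exponents e'; it is the identity in cohomological degree 0. *)
Fixpoint ktrans V y e e' r : koszul V r -> koszul V r :=
  match r with
  | 0 => id
  | r'.+1 => fun c => (ktrans y e e' c.1, y r' ^+ (e' r' - e r') *: ktrans y e e' c.2)
  end.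

(** The cochains of cohomological degree i and internal degree n with values in
the graded family L.  Raising the exponent of y_j, of degree one, is
compensated by a shift of the component where y_j occurs, so that [kdiff] and
[ktrans] preserve n.  The degree i is an integer to have no special case at
i = 0. *)
Fixpoint cochain V (L : int -> set V) e r (i n : int) : set (koszul V r) :=
  match r with
  | 0 => fun v => if i == 0 then L n v else v = 0
  | r'.+1 => fun c => cochain L e i n c.1 /\ cochain L e (i - 1) (n + (e r')%:Z) c.2
  end.

Definition stable V y (L : int -> set V) :=
  [/\ forall n, L n 0, forall n u v, L n u -> L n v -> L n (u - v)
    & forall n j v, L n v -> L (n + 1) (y j *: v)].

Definition zero_fam V : int -> set V := fun _ => [set 0].

Section Basic.
Variables (V : lmodType S) (y : nat -> S).

Lemma kdiffB e r : {morph @kdiff V y e r : a b / a - b}.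
Proof.
elim: r => [|r IH] /= a b; first by rewrite subr0.
by rewrite !IH; congr pair; rewrite /= scalerBr !opprD addrACA.
Qed.

Lemma kdiff0 e r : @kdiff V y e r 0 = 0.
Proof. by rewrite -[X in kdiff y e X](subrr 0) kdiffB subrr. Qed.

Lemma kdiffN e r a : @kdiff V y e r (- a) = - kdiff y e a.
Proof. by rewrite -[in LHS]sub0r kdiffB kdiff0 sub0r. Qed.

Lemma kdiffD e r : {morph @kdiff V y e r : a b / a + b}.
Proof. by move=> a b; rewrite -[b in LHS]opprK kdiffB kdiffN opprK. Qed.

Lemma kdiffZ e r s a : @kdiff V y e r (s *: a) = s *: kdiff y e a.
Proof.
elim: r a => [|r IH] /= a; first by rewrite scaler0.
by rewrite !IH; congr pair; rewrite /= scalerBr !scalerA mulrC.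
Qed.

Lemma kdiffK e r a : kdiff y e (@kdiff V y e r a) = 0.
Proof.
elim: r a => [|r IH] //= a.
by rewrite IH kdiffB IH subr0 kdiffZ subrr.
Qed.

Lemma ktransB e e' r : {morph @ktrans V y e e' r : a b / a - b}.
Proof. by elim: r => [|r IH] //= a b; rewrite !IH scalerBr. Qed.

Lemma ktrans0 e e' r : @ktrans V y e e' r 0 = 0.
Proof. by rewrite -[X in ktrans y e e' X](subrr 0) ktransB subrr. Qed.

Lemma ktransN e e' r a : @ktrans V y e e' r (- a) = - ktrans y e e' a.
Proof. by rewrite -[in LHS]sub0r ktransB ktrans0 sub0r. Qed.

Lemma ktransZ e e' r s a : @ktrans V y e e' r (s *: a) = s *: ktrans y e e' a.
Proof.
elim: r a => [|r IH] //= a.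
by rewrite !IH; congr pair; rewrite /= !scalerA mulrC.
Qed.

Definition exp_le (e e' : nat -> nat) := forall j, (e j <= e' j)%N.

Lemma exp_le_trans e1 e2 e3 : exp_le e1 e2 -> exp_le e2 e3 -> exp_le e1 e3.
Proof. by move=> h1 h2 j; apply: leq_trans (h1 j) (h2 j). Qed.

Lemma ktrans_kdiff e e' r a : exp_le e e' ->
  ktrans y e e' (@kdiff V y e r a) = kdiff y e' (ktrans y e e' a).
Proof.
move=> le; elim: r a => [|r IH] //= a.
rewrite !IH ktransB ktransZ IH kdiffZ; congr pair; rewrite /= scalerBr scalerA -exprD.
by rewrite subnK // le.
Qed.

Lemma ktrans_ktrans e1 e2 e3 r a : exp_le e1 e2 -> exp_le e2 e3 ->
  ktrans y e2 e3 (@ktrans V y e1 e2 r a) = ktrans y e1 e3 a.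
Proof.
move=> h12 h23; elim: r a => [|r IH] //= a.
rewrite !ktransZ !IH scalerA -exprD; congr (_, _ ^+ _ *: _).
by have := h12 r; have := h23 r; lia.
Qed.

Lemma ktrans_id e r a : @ktrans V y e e r a = a.
Proof. by elim: r a => [|r IH] //= [a b] /=; rewrite !IH subnn expr0 scale1r. Qed.

End Basic.

Section Pieces.
Variables (V : lmodType S) (y : nat -> S).
Implicit Types L N : int -> set V.

Lemma stableX L j k n v : stable y L -> L n v -> L (n + k%:Z) (y j ^+ k *: v).
Proof.
move=> [_ _ sL]; elim: k n v => [|k IH] n v Lv; first by rewrite addr0 expr0 scale1r.
rewrite exprSr -scalerA -addn1 PoszD addrC -addrA [1 + n]addrC addrC.
by apply: IH; apply: sL.
Qed.

Lemma cochain0 L e r i n : stable y L -> cochain L e i n (0 : koszul V r).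
Proof. by move=> [L0 _ _]; elim: r i n => [|r IH] i n /=; [case: eqP|]. Qed.

Lemma cochainB L e r i n (a b : koszul V r) : stable y L ->
  cochain L e i n a -> cochain L e i n b -> cochain L e i n (a - b).
Proof.
move=> sL; elim: r i n a b => [|r IH] i n a b /=.
  by case: eqP => [_|_ -> ->]; [case: sL => _ + _; apply|rewrite subr0].
by move=> [a1 a2] [b1 b2]; split; apply: IH.
Qed.

Lemma cochainN L e r i n (a : koszul V r) : stable y L -> cochain L e i n a -> cochain L e i n (- a).
Proof. by move=> sL ka; rewrite -sub0r; apply: cochainB => //; apply: cochain0. Qed.

Lemma cochainD L e r i n (a b : koszul V r) : stable y L ->
  cochain L e i n a -> cochain L e i n b -> cochain L e i n (a + b).
Proof. by move=> sL ka kb; rewrite -[b]opprK; apply: cochainB => //; apply: cochainN. Qed.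

Lemma cochainS L N e r i n (a : koszul V r) : (forall m v, n <= m -> L m v -> N m v) ->
  cochain L e i n a -> cochain N e i n a.
Proof.
elim: r i n a => [|r IH] i n a LN /=; first by case: eqP => // _; apply: LN.
move=> [a1 a2]; split; apply: IH => // m v nm; apply: LN.
by apply: le_trans nm; rewrite lerDl.
Qed.

Lemma cochain_scale L N s k e r i n (a : koszul V r) :
  (forall m v, L m v -> N (m + k) (s *: v)) ->
  cochain L e i n a -> cochain N e i (n + k) (s *: a).
Proof.
move=> LN; elim: r i n a => [|r IH] i n a /=.
  by case: eqP => [_ /LN//|_ ->]; rewrite scaler0.
by move=> [a1 a2]; split; [exact: IH|rewrite addrAC; exact: IH].
Qed.

Lemma cochain_scaleX L j k e r i n (a : koszul V r) : stable y L ->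
  cochain L e i n a -> cochain L e i (n + k%:Z) (y j ^+ k *: a).
Proof. by move=> sL; apply: cochain_scale => m v; apply: stableX. Qed.

Lemma cochain_kdiff L e r i n (a : koszul V r) : stable y L ->
  cochain L e i n a -> cochain L e (i + 1) n (kdiff y e a).
Proof.
move=> sL; elim: r i n a => [|r IH] i n a /=; first by move=> _; exact: (@cochain0 L e 0).
move=> [a1 a2]; split; first exact: IH.
rewrite addrK; apply: cochainB => //; first exact: cochain_scaleX.
by rewrite -[i in cochain _ _ i _ _](subrK 1); apply: IH.
Qed.

Lemma cochain_ktrans L e e' r i n (a : koszul V r) : stable y L -> exp_le e e' ->
  cochain L e i n a -> cochain L e' i n (ktrans y e e' a).
Proof.
move=> sL le; elim: r i n a => [|r IH] i n a //=.
move=> [a1 a2]; split; first exact: IH.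
have -> : (e' r)%:Z = (e r)%:Z + (e' r - e r)%:Z.
  by rewrite -PoszD subnKC // le.
by rewrite addrA; apply: cochain_scaleX => //; apply: IH.
Qed.

Lemma cochain_neg L e r i n (a : koszul V r) : i < 0 -> cochain L e i n a -> a = 0.
Proof.
elim: r i n a => [|r IH] i n a i0 /=; first by case: eqP => // i0'; lia.
by case: a => a b /= [/IH-> // /IH->]//; lia.
Qed.

End Pieces.
End Koszul.

(** * Vanishing of the colimit, long exact sequences and change of module *)

Section Vanishing.
Variable S : comNzRingType.

(** The colimit is taken over the exponents of y_f, y_(f+1), ... only, the first
f of them being kept equal to 1.  For f = 0 this is local cohomology; the
other values are the intermediate steps of [regularity_nonneg]. *)
Definition frozen f (e : nat -> nat) := forall j, (j < f)%N -> e j = 1%N.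

(** The class of c, a cocycle of L/N, dies in the colimit. *)
Definition cobounds (V : lmodType S) y r f (L N : int -> set V) e (i n : int)
    (c : koszul V r) :=
  exists e' b, [/\ exp_le e e', frozen f e', cochain L e' (i - 1) n b
    & cochain N e' i n (ktrans y e e' c - kdiff y e' b)].

(** The colimit of the cohomology of L/N vanishes in bidegree (i, n). *)
Definition vanishes (V : lmodType S) y r f (L N : int -> set V) (i n : int) :=
  forall e (c : koszul V r), frozen f e ->
    cochain L e i n c -> cochain N e (i + 1) n (kdiff y e c) -> cobounds y f L N e i n c.

Lemma cobounds_ktrans (V : lmodType S) y r f (L N : int -> set V) e e' i n (c : koszul V r) :
  exp_le e e' -> cobounds y f L N e' i n (ktrans y e e' c) -> cobounds y f L N e i n c.
Proof.
move=> le [e2 [b [le2 fr Lb Nb]]]; exists e2, b; split=> //; first exact: exp_le_trans le2.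
by rewrite -(ktrans_ktrans _ _ le le2).
Qed.

Lemma cobounds_add (V : lmodType S) y r f (L N : int -> set V) e i n (c b : koszul V r) :
  stable y L -> cochain L e (i - 1) n b ->
  cobounds y f L N e i n (c - kdiff y e b) -> cobounds y f L N e i n c.
Proof.
move=> sL Lb [e2 [b' [le2 fr Lb' Nb]]]; exists e2, (b' + ktrans y e e2 b); split=> //.
  by apply: (cochainD sL) => //; exact: cochain_ktrans.
by rewrite kdiffD [kdiff _ _ b' + _]addrC opprD addrA -ktrans_kdiff // -ktransB.
Qed.

Lemma cobounds_mod (V : lmodType S) y r f (L N : int -> set V) e i n (c c' : koszul V r) :
  stable y N -> cochain N e i n c' ->
  cobounds y f L N e i n (c - c') -> cobounds y f L N e i n c.
Proof.
move=> sN Nc' [e2 [b' [le2 fr Lb' Nb]]]; exists e2, b'; split=> //.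
rewrite -[ktrans y e e2 c](subrK (ktrans y e e2 c')) addrAC -ktransB.
by apply: (cochainD sN) => //; exact: cochain_ktrans.
Qed.

Lemma cobounds0 (V : lmodType S) y r f (L N : int -> set V) e i n (c : koszul V r) :
  stable y L -> frozen f e -> cochain N e i n c -> cobounds y f L N e i n c.
Proof.
move=> sL fr Nc; exists e, 0; split=> //.
  exact: cochain0 sL.
by rewrite ktrans_id kdiff0 subr0.
Qed.

Lemma van_neg (V : lmodType S) y r f (L N : int -> set V) i n :
  stable y L -> stable y N -> i < 0 -> vanishes y r f L N i n.
Proof.
move=> sL sN i0 e c fr Lc _; apply: cobounds0 => //.
by rewrite (cochain_neg i0 Lc); apply: cochain0 sN.
Qed.

Lemma van_above (V : lmodType S) y r f (L N : int -> set V) i n :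
  stable y L -> (forall m v, n <= m -> L m v -> N m v) -> vanishes y r f L N i n.
Proof. by move=> sL LN e c fr Lc _; apply: cobounds0 => //; apply: cochainS Lc. Qed.

(** The three exactness statements of the long exact sequence of a filtration
L0 <= L1 <= L2, in terms of vanishing: for the middle term L2/L0, for the
subobject L1/L0 and for the quotient L2/L1. *)
Section LES.
Variables (V : lmodType S) (y : nat -> S) (r f : nat).
Variables (L0 L1 L2 : int -> set V).
Hypotheses (s0 : stable y L0) (s1 : stable y L1) (s2 : stable y L2).
Hypotheses (L01 : forall n v, L0 n v -> L1 n v) (L12 : forall n v, L1 n v -> L2 n v).

Let k01 e i n (c : koszul V r) : cochain L0 e i n c -> cochain L1 e i n c.
Proof. by apply: cochainS => m v _; apply: L01. Qed.
Let k12 e i n (c : koszul V r) : cochain L1 e i n c -> cochain L2 e i n c.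
Proof. by apply: cochainS => m v _; apply: L12. Qed.

Lemma van_ext i n :
  vanishes y r f L1 L0 i n -> vanishes y r f L2 L1 i n -> vanishes y r f L2 L0 i n.
Proof.
move=> vL vQ e c fr Lc dc.
have [e' [b [le fr' Lb Nb]]] := vQ e c fr Lc (k01 dc).
apply: (cobounds_ktrans le); apply: (cobounds_add s2 Lb).
have [|e2 [b2 [le2 fr2 Lb2 Nb2]]] := vL e' _ fr' Nb.
  by rewrite kdiffB kdiffK subr0 -ktrans_kdiff //; apply: cochain_ktrans.
by exists e2, b2; split=> //; apply: k12.
Qed.

Lemma van_sub i n :
  vanishes y r f L2 L1 (i - 1) n -> vanishes y r f L2 L0 i n -> vanishes y r f L1 L0 i n.
Proof.
move=> vQ vL e c fr Lc dc.
have [e' [b [le fr' Lb Nb]]] := vL e c fr (k12 Lc) dc.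
have [|e2 [b2 [le2 fr2 Lb2 Nb2]]] := vQ e' b fr' Lb.
  rewrite subrK; have := cochainB s1 (cochain_ktrans s1 le Lc) (k01 Nb).
  by rewrite opprB addrC subrK.
exists e2, (ktrans y e' e2 b - kdiff y e2 b2); split=> //; first exact: exp_le_trans le2.
by rewrite kdiffB kdiffK subr0 -ktrans_kdiff // -(ktrans_ktrans _ _ le le2) -ktransB; apply: cochain_ktrans.
Qed.

Lemma van_quo i n :
  vanishes y r f L2 L0 i n -> vanishes y r f L1 L0 (i + 1) n -> vanishes y r f L2 L1 i n.
Proof.
move=> vL vK e c fr Lc dc.
have [|e' [b [le fr' Lb Nb]]] := vK e _ fr dc; first by rewrite kdiffK; apply: cochain0 s0.
rewrite addrK in Lb.
apply: (cobounds_ktrans le); apply: (cobounds_mod s1 Lb).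
have [|||e2 [b2 [le2 fr2 Lb2 Nb2]]] := vL e' (ktrans y e e' c - b) => //.
- by apply: (cochainB s2); [exact: cochain_ktrans|exact: k12].
- by rewrite kdiffB -ktrans_kdiff.
by exists e2, b2; split=> //; apply: k01.
Qed.
End LES.

Lemma cochain_shift (V : lmodType S) (L : int -> set V) s e r i n (c : koszul V r) :
  cochain (fun m => L (m + s)) e i n c <-> cochain L e i (n + s) c.
Proof.
elim: r i n c => [|r IH] i n c //=.
by rewrite !IH addrAC.
Qed.

Lemma van_shift (V : lmodType S) y r f (L N : int -> set V) s i n :
  vanishes y r f (fun m => L (m + s)) (fun m => N (m + s)) i n <->
  vanishes y r f L N i (n + s).
Proof.
split=> v e c fr Lc Nc.
- have [||e' [b [le fr' Lb Nb]]] := v e c fr; [exact/cochain_shift..|].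
  by exists e', b; split=> //; apply/cochain_shift.
- move/cochain_shift: Lc => Lc; move/cochain_shift: Nc => Nc.
  have [e' [b [le fr' Lb Nb]]] := v e c fr Lc Nc.
  by exists e', b; split=> //; apply/cochain_shift.
Qed.

End Vanishing.

(** A map that is semilinear for a pairing of the y_j with the z_j and induces
an isomorphism of L/N with L'/N'.  The base rings may differ, as for the
projection of the Rees algebra onto the associated graded ring. *)
Section Transport.
Variables (S T : comNzRingType) (V : lmodType S) (W : lmodType T).
Variables (y : nat -> S) (z : nat -> T) (phi : V -> W).
Hypothesis phiB : {morph phi : u v / u - v}.
Hypothesis phiY : forall j v, phi (y j *: v) = z j *: phi v.

Fixpoint koszul_map r : koszul V r -> koszul W r :=
  match r with
  | 0 => phi
  | r'.+1 => fun c => (koszul_map c.1, koszul_map c.2)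
  end.

Lemma phiX j k v : phi (y j ^+ k *: v) = z j ^+ k *: phi v.
Proof.
elim: k => [|k IH]; first by rewrite !expr0 !scale1r.
by rewrite !exprS -!scalerA phiY IH.
Qed.

Lemma koszul_mapB r : {morph @koszul_map r : a b / a - b}.
Proof. by elim: r => [|r IH] //= a b; rewrite !IH. Qed.

Lemma koszul_mapX r j k a : @koszul_map r (y j ^+ k *: a) = z j ^+ k *: koszul_map a.
Proof.
elim: r a => [|r IH] /= a; first exact: phiX.
by rewrite !IH.
Qed.

Lemma koszul_map0 r : @koszul_map r 0 = 0.
Proof. by rewrite -[X in koszul_map X](subrr 0) koszul_mapB subrr. Qed.

Lemma koszul_map_kdiff e r c : @koszul_map r (kdiff y e c) = kdiff z e (koszul_map c).
Proof.
elim: r c => [|r IH] c /=; first exact: (@koszul_map0 0).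
by rewrite koszul_mapB koszul_mapX !IH.
Qed.

Lemma koszul_map_ktrans e e' r c : @koszul_map r (ktrans y e e' c) = ktrans z e e' (koszul_map c).
Proof. by elim: r c => [|r IH] c //=; rewrite koszul_mapX !IH. Qed.

Section KmapPieces.
Variables (L : int -> set V) (L' : int -> set W).

Lemma koszul_map_cochain e r i n c : (forall m v, L m v -> L' m (phi v)) ->
  cochain L e i n c -> cochain L' e i n (@koszul_map r c).
Proof.
move=> LL; elim: r i n c => [|r IH] i n c /=.
  by case: eqP => [_ /LL //|_ ->]; apply: (@koszul_map0 0).
by case=> c1 c2; split; apply: IH.
Qed.

Lemma koszul_map_lift e r i n c (N' : int -> set W) :
  (forall m, N' m 0) -> (forall m, L m 0) -> 
  (forall m w, L' m w -> exists2 v, L m v & N' m (w - phi v)) ->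
  cochain L' e i n c -> exists2 b, cochain L e i n b & cochain N' e i n (c - @koszul_map r b).
Proof.
move=> N0 L0 lift; elim: r i n c => [|r IH] i n c /=.
  case: eqP => [_ /lift //|_ ->]; exists 0 => //.
  by rewrite (@koszul_map0 0 : phi 0 = 0) subr0.
case=> /IH[b1 Lb1 Nb1] /IH[b2 Lb2 Nb2]; exists (b1, b2) => //.
Qed.
End KmapPieces.

Lemma koszul_map_reflect (L N : int -> set V) (N' : int -> set W) e r i n c :
  (forall m v, L m v -> N' m (phi v) -> N m v) ->
  cochain L e i n c -> cochain N' e i n (@koszul_map r c) -> cochain N e i n c.
Proof.
move=> LN; elim: r i n c => [|r IH] i n c /=.
  by case: eqP => // _; apply: LN.
by move=> [c1 c2] [d1 d2]; split; apply: IH.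
Qed.

Variables (L N : int -> set V) (L' N' : int -> set W).
Hypotheses (sL : stable y L) (sN' : stable z N').
Hypothesis LL' : forall m v, L m v -> L' m (phi v).
Hypothesis NN' : forall m v, L m v -> (N m v <-> N' m (phi v)).
Hypothesis lift : forall m w, L' m w -> exists2 v, L m v & N' m (w - phi v).
Hypothesis NL : forall m w, N m w -> L m w.

Let lift_cochain e r i n c : cochain L' e i n c ->
  exists2 b, cochain L e i n b & cochain N' e i n (c - @koszul_map r b).
Proof. by apply: koszul_map_lift => // m; [case: sN'|case: sL]. Qed.

Lemma van_transport r f i n : vanishes y r f L N i n <-> vanishes z r f L' N' i n.
Proof.
split=> v e c fr Lc dc.
- have [c0 Lc0 Nc0] := lift_cochain Lc.
  apply: (cobounds_mod sN' Nc0); rewrite opprB addrC subrK.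
  have [|e' [b [le fr' Lb Nb]]] := v e c0 fr Lc0.
    apply: (@koszul_map_reflect L N N'); first by move=> m w /NN' h /h.
      exact: cochain_kdiff.
    rewrite koszul_map_kdiff; have := cochainB sN' dc (cochain_kdiff sN' Nc0).
    by rewrite -kdiffB opprB [c + _]addrC subrK.
  exists e', (koszul_map b); split=> //; first exact: koszul_map_cochain Lb.
  rewrite -koszul_map_ktrans -koszul_map_kdiff -koszul_mapB; apply: koszul_map_cochain Nb => m w Nw.
  by apply/NN'; [exact: NL|].
- have [|||e' [b [le fr' Lb Nb]]] := v e (koszul_map c) => //; first exact: koszul_map_cochain Lc.
    rewrite -koszul_map_kdiff; apply: koszul_map_cochain dc => m w Nw.
    by apply/NN'; [exact: NL|].
  have [b0 Lb0 Nb0] := lift_cochain Lb.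
  exists e', b0; split=> //.
  apply: (@koszul_map_reflect L N N'); first by move=> m w /NN' h /h.
    apply: (cochainB sL); first exact: cochain_ktrans.
    by rewrite -[i](subrK 1); apply: cochain_kdiff.
  rewrite koszul_mapB koszul_map_ktrans koszul_map_kdiff.
  have := cochain_kdiff sN' Nb0; rewrite subrK => /(cochainD sN' Nb).
  by rewrite kdiffB addrA subrK.
Qed.
End Transport.

(** * Replacing the colimit over exponents by exponent one *)

Section Ext.
Variables (S : comNzRingType) (V : lmodType S) (y : nat -> S).

Lemma kdiff_ext e e' r (c : koszul V r) :
  (forall j, (j < r)%N -> e j = e' j) -> kdiff y e c = kdiff y e' c.
Proof.
elim: r c => [|r IH] c h //=; rewrite !IH; first by rewrite h.
all: by move=> j jr; apply: h; apply: ltnW.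
Qed.

Lemma ktrans_ext e1 e1' e2 e2' r (c : koszul V r) :
  (forall j, (j < r)%N -> e1 j = e1' j /\ e2 j = e2' j) ->
  ktrans y e1 e2 c = ktrans y e1' e2' c.
Proof.
elim: r c => [|r IH] c h //=; rewrite !IH; first by have [-> ->] := h r (ltnSn r).
all: by move=> j jr; apply: h; apply: ltnW.
Qed.

Lemma cochain_ext (L : int -> set V) e e' r i n (c : koszul V r) :
  (forall j, (j < r)%N -> e j = e' j) -> cochain L e i n c -> cochain L e' i n c.
Proof.
elim: r i n c => [|r IH] i n c h //= [c1 c2].
split; first by apply: IH c1 => j jr; apply: h; apply: ltnW.
by rewrite -h //; apply: IH c2 => j jr; apply: h; apply: ltnW.
Qed.

End Ext.

Definition prepend (T : Type) (z : T) (y : nat -> T) j := if j is j'.+1 then y j' else z.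

Lemma prepend_eta (T : Type) (y : nat -> T) : prepend (y 0%N) (fun j => y j.+1) = y.
Proof. by apply/funext => -[|j]. Qed.

Section Rotation.
Variables (S : comNzRingType) (V : lmodType S) (y : nat -> S) (z : S).

(** The outermost element z of the complex is made the innermost one.  The sign
comes from the interchange of two mapping cones. *)
Fixpoint rotate r : koszul V r.+1 -> koszul V r.+1 :=
  match r with
  | 0 => id
  | r'.+1 => fun c => (rotate (c.1.1, c.2.1), rotate (c.1.2, - c.2.2))
  end.

Lemma rotateB r : {morph @rotate r : u v / u - v}.
Proof.
elim: r => [|n IHn] //= u v; congr pair; rewrite /= -IHn //; congr (rotate (_, _)).
by rewrite /= opprD.
Qed.

Lemma rotateZ r s u : @rotate r (s *: u) = s *: rotate u.
Proof.
elim: r u => [|n IHn] //= u; congr pair; rewrite /= -IHn //; congr (rotate (_, _)).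
by rewrite /= scalerN.
Qed.

Lemma rotate_kdiff q e r (a b : koszul V r) :
  rotate (kdiff y e a, z ^+ q *: a - kdiff y e b)
  = kdiff (prepend z y) (prepend q e) (rotate (a, b) : koszul V r.+1).
Proof.
elim: r a b => [|r IH] //= [a1 a2] [b1 b2] /=.
rewrite IH; congr pair.
rewrite -[X in _ = _ - X]/(kdiff (prepend z y) (prepend q e) (rotate (a2, - b2) : koszul V r.+1)).
rewrite -IH -rotateZ -rotateB; congr (rotate (_, _)) => /=.
by rewrite kdiffN opprK opprB opprD addrA addrAC.
Qed.

Lemma rotate_ktrans q q' e e' r (a b : koszul V r) :
  rotate (ktrans y e e' a, z ^+ (q' - q) *: ktrans y e e' b)
  = ktrans (prepend z y) (prepend q e) (prepend q' e') (rotate (a, b) : koszul V r.+1).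
Proof.
elim: r a b => [|r IH] //= [a1 a2] [b1 b2] /=.
rewrite IH; congr pair.
rewrite -[X in _ = _ *: X]/(ktrans (prepend z y) (prepend q e) (prepend q' e') (rotate (a2, - b2) : koszul V r.+1)).
rewrite -IH -rotateZ; congr (rotate (_, _)) => /=.
by rewrite ktransN !scalerN !scalerA mulrC.
Qed.

Lemma rotate_cochain (Y : nat -> S) (L : int -> set V) q e r i n (a b : koszul V r) :
  stable Y L ->
  cochain L e i n a /\ cochain L e (i - 1) (n + q%:Z) b <->
  cochain L (prepend q e) i n (rotate (a, b) : koszul V r.+1).
Proof.
move=> sL; elim: r i n a b => [|r IH] i n a b //=.
case: a b => [a1 a2] [b1 b2] /=.
have := IH i n a1 b1; have := IH (i - 1) (n + (e r)%:Z) a2 (- b2).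
rewrite /= => <- <-.
have Nb2 : cochain L e (i - 1 - 1) (n + (e r)%:Z + q%:Z) (- b2) <->
           cochain L e (i - 1 - 1) (n + q%:Z + (e r)%:Z) b2.
  by rewrite [n + _ + _]addrAC; split=> /(cochainN sL); rewrite ?opprK.
by rewrite Nb2; split=> [[[? ?] []]|[[? ?] []]].
Qed.

Lemma rotate_surj r (c : koszul V r.+1) : exists a b, c = rotate (a, b).
Proof.
elim: r c => [|r IH] [c d]; first by exists c, d.
have [a1 [b1 ->]] := IH c; have [a2 [b2 ->]] := IH d.
by exists (a1, a2), (b1, - b2); rewrite /= opprK.
Qed.
End Rotation.

Section Freeze.
Variables (S : comNzRingType) (V : lmodType S) (L N : int -> set V).

Definition update_exp (e : nat -> nat) r q j := if j == r then q else e j.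

Lemma update_exp_lt e r q j : (j < r)%N -> update_exp e r q j = e j.
Proof. by rewrite /update_exp => /ltn_eqF->. Qed.

Lemma update_exp_eq e r q : update_exp e r q r = q.
Proof. by rewrite /update_exp eqxx. Qed.

Lemma frozen_update e r q f : (f <= r)%N -> frozen f e -> frozen f (update_exp e r q).
Proof. by move=> fr fe j jf; rewrite update_exp_lt ?fe //; apply: leq_trans fr. Qed.

Section Step.
Variables (y : nat -> S) (r f : nat) (i n : int).
Hypotheses (sL : stable y L) (sN : stable y N) (fr : (f <= r)%N).
Hypothesis H : vanishes y r.+1 f L N i n.

(** Multiplication by a power of y_r is injective on the cohomology of the first
r elements in bidegree (i, n): if y_r^q a is the coboundary of b, then (a, b) is
a cocycle of the complex on r+1 elements. *)
Lemma van_kernel e q (a b : koszul V r) : frozen f e ->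
  cochain L e i n a -> cochain N e (i + 1) n (kdiff y e a) ->
  cochain L e (i - 1) (n + q%:Z) b -> cochain N e i (n + q%:Z) (y r ^+ q *: a - kdiff y e b) ->
  cobounds y f L N e i n a.
Proof.
move=> fe La Na Lb Nab; pose E := update_exp e r q.
have ext j : (j < r)%N -> e j = E j by move=> jr; rewrite /E update_exp_lt.
have Er : E r = q by rewrite /E update_exp_eq.
have [|||E' [[a' b'] [le fE' /= [La' Lb'] [Na' Nb']]]] := H (e := E) (c := (a, b)).
- exact: frozen_update.
- by split=> /=; rewrite ?Er; apply: (cochain_ext ext).
- split=> /=; first by rewrite -(kdiff_ext _ _ ext); apply: (cochain_ext ext).
  by rewrite addrK !Er -(kdiff_ext _ _ ext); apply: (cochain_ext ext).
have ext' j : (j < r)%N -> E' j = update_exp E' r (e r) j by move=> jr; rewrite update_exp_lt.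
exists (update_exp E' r (e r)), a'; split.
- move=> j; rewrite /update_exp; case: eqP => [->//|/eqP jr].
  by have := le j; rewrite /E /update_exp (negPf jr).
- exact: frozen_update.
- exact: (cochain_ext ext').
rewrite -(kdiff_ext _ _ ext'); apply: (cochain_ext ext').
rewrite -[ktrans y e _ _](@ktrans_ext _ _ _ E _ E') // => j jr.
by rewrite ext // ext'.
Qed.

(** The cocycle (0, b) bounds, which makes b divisible by y_r up to
y_r-torsion.  That torsion is removed later by [van_kernel], in bidegree
(i-1, n+1), which is on the same line n+i. *)
Lemma van_cokernel e (b : koszul V r) : frozen f e ->
  cochain L e (i - 1) (n + 1) b -> cochain N e i (n + 1) (kdiff y e b) ->
  exists E m p s, [/\ exp_le e E, frozen f E, cochain L E (i - 1) n p, cochain N E i n (kdiff y E p) &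
    cochain L E (i - 1 - 1) (n + 1 + m%:Z) s /\
    cochain N E (i - 1) (n + 1 + m%:Z) (y r ^+ m *: (y r *: p - ktrans y e E b) - kdiff y E s)].
Proof.
move=> fe Lb Nb; pose E := update_exp e r 1.
have ext j : (j < r)%N -> e j = E j by move=> jr; rewrite /E update_exp_lt.
have Er : E r = 1%N by rewrite /E update_exp_eq.
have [|||E' [[p s] [le fE' /= [Lp Ls] [Np Ns]]]] := H (e := E) (c := (0, b)).
- exact: frozen_update.
- by split=> /=; [exact: cochain0 sL|rewrite Er; apply: (cochain_ext ext)].
- split=> /=; first by rewrite kdiff0; apply: cochain0 sN.
  rewrite addrK !Er -(kdiff_ext _ _ ext) scaler0 sub0r; apply: (cochain_ext ext).
  exact: cochainN sN _.
have ext' j : (j < r)%N -> E' j = update_exp E' r (e r) j by move=> jr; rewrite update_exp_lt.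
have E'r : (0 < E' r)%N by have := le r; rewrite Er.
exists (update_exp E' r (e r)), (E' r).-1, p, s.
have -> : n + 1 + (E' r).-1%:Z = n + (E' r)%:Z by lia.
split.
- move=> j; rewrite /update_exp; case: eqP => [->//|/eqP jr].
  by have := le j; rewrite /E /update_exp (negPf jr).
- exact: frozen_update.
- exact: (cochain_ext ext').
- rewrite -(kdiff_ext _ _ ext'); apply: (cochain_ext ext').
  by move: Np; rewrite ktrans0 sub0r => /(cochainN sN); rewrite opprK.
split; first exact: (cochain_ext ext').
rewrite -(kdiff_ext _ _ ext'); apply: (cochain_ext ext').
rewrite -[ktrans y e _ _](@ktrans_ext _ _ _ E _ E'); last by move=> j jr; rewrite ext // ext'.
move/(cochainN sN): Ns; congr cochain.
by rewrite Er opprB addrC scalerBr scalerA -exprSr prednK // subn1 addrCA addrA.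
Qed.
End Step.

(** Let h be the cohomology of the first r elements.  By hypothesis the
localisation map from h to h_(y_r) is injective for n+i >= 0 and surjective for
n+i >= -1, hence y_r: h^i_(n-1) -> h^i_n is surjective for n+i >= 0 and
injective for n+i >= 1.  This says precisely that the cone of y_r itself, with
exponent one, has no cohomology for n+i >= 0.  The frozen element is then moved
to the innermost position, so that the next one is outermost. *)
Lemma van_freeze (y : nat -> S) r f : stable y L -> stable y N ->
  (f <= r)%N -> (forall i n, 0 <= n + i -> vanishes y r.+1 f L N i n) ->
  forall i n, 0 <= n + i -> vanishes (prepend (y r) y) r.+1 f.+1 L N i n.
Proof.
move=> sL sN fr H i n ni e0 c0 fe0.
have [a [b ->]] := rotate_surj c0.
pose e j := e0 j.+1.
have -> : e0 = prepend 1%N e by rewrite -[LHS]prepend_eta fe0.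
rewrite -rotate_kdiff expr1 => Lc Nc.
have [La Lb] := (rotate_cochain 1%N e i n a b sL).2 Lc.
have [Na] := (rotate_cochain 1%N e (i + 1) n (kdiff y e a) (y r *: a - kdiff y e b) sN).2 Nc.
rewrite addrK => Nb.
have fe : frozen f e by move=> j jf; apply: fe0.
have [|e1 [a1 [le1 f1 La1 Na1]]] := van_kernel fr (H _ _ ni) fe La Na Lb.
  by rewrite expr1.
(* modulo the coboundary of (a1, 0) the cocycle (a, b) becomes (0, b1) *)
pose b1 := ktrans y e e1 b - y r *: a1.
have scaleL m e' j (w : koszul V r) : cochain L e' j m w -> cochain L e' j (m + 1) (y r *: w).
  by apply: cochain_scale => k v; case: sL => _ _; apply.
have scaleN m e' j (w : koszul V r) : cochain N e' j m w -> cochain N e' j (m + 1) (y r *: w).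
  by apply: cochain_scale => k v; case: sN => _ _; apply.
have Lb1 : cochain L e1 (i - 1) (n + 1) b1.
  by apply: (cochainB sL); [exact: cochain_ktrans|exact: scaleL].
have Nb1 : cochain N e1 i (n + 1) (kdiff y e1 b1).
  rewrite kdiffB kdiffZ -ktrans_kdiff //.
  have := cochainB sN (scaleN _ _ _ _ Na1) (cochain_ktrans sN le1 Nb); congr cochain.
  by rewrite ktransB ktransZ scalerBr opprB addrC addrA subrK.
(* y_r p and b1 differ by a class killed by y_r^m, hence by zero: see e3 *)
have [E [m [p [s [le2 fE Lp Np [Ls Ns]]]]]] := van_cokernel sL sN fr (H _ _ ni) f1 Lb1 Nb1.
have ni' : 0 <= n + 1 + (i - 1) by lia.
have [||e3 [b3 [le3 f3 Lb3 Nb3]]] := van_kernel fr (H _ _ ni') fE _ _ Ls Ns.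
- by apply: (cochainB sL); [exact: scaleL|exact: cochain_ktrans].
- by rewrite subrK kdiffB kdiffZ -ktrans_kdiff //; apply: (cochainB sN); [exact: scaleN|exact: cochain_ktrans].
have le12 := exp_le_trans le1 le2; have le13 := exp_le_trans le12 le3.
exists (prepend 1%N e3), (rotate (ktrans y e1 e3 a1 + ktrans y E e3 p, b3)); split.
- by case=> [|j] //=.
- by case=> [|j] //=; apply: f3.
- apply: (rotate_cochain 1%N e3 (i - 1) n _ _ sL).1; split=> //.
  apply: (cochainD sL); apply: cochain_ktrans => //; exact: exp_le_trans le3.
rewrite -rotate_kdiff -rotate_ktrans -rotateB; apply: (rotate_cochain 1%N e3 i n _ _ sN).1; split=> /=.
  rewrite kdiffD opprD addrA -(ktrans_ktrans _ _ le1 (exp_le_trans le2 le3)) -!ktrans_kdiff //; last exact: exp_le_trans le3.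
  rewrite -ktransB; apply: (cochainB sN); apply: cochain_ktrans => //; exact: exp_le_trans le3.
rewrite subnn expr0 expr1 scale1r.
have := cochainN sN Nb3; congr cochain.
rewrite ktransB ktransZ (ktrans_ktrans _ _ le2 le3) /b1 ktransB (ktrans_ktrans _ _ le1 (exp_le_trans le2 le3)) ktransZ scalerDr.
rewrite [- (ktrans y e e3 b - _)]opprB addrA [y r *: _ + y r *: _]addrC.
by rewrite [_ - ktrans y e e3 b - _]addrAC opprB.
Qed.

End Freeze.

Section Top.
Variables (S : comNzRingType) (V : lmodType S) (L N : int -> set V).

Fixpoint top_cochain r (v : V) : koszul V r :=
  if r is r'.+1 then (0, top_cochain r' v) else v.

Lemma cochain_top (M : int -> set V) (y : nat -> S) r n v : stable y M ->
  cochain M (fun=> 1%N) r%:Z n (top_cochain r v) <-> M (n + r%:Z) v.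
Proof.
move=> sL; elim: r n => [|r IH] n /=; first by rewrite addr0.
have -> : r.+1%:Z - 1 = r%:Z by lia.
have -> : n + r.+1%:Z = n + 1 + r%:Z by lia.
by rewrite IH; split=> [[]//|h]; split=> //; apply: cochain0 sL.
Qed.

Lemma kdiff_top y e r v : kdiff y e (top_cochain r v) = 0.
Proof. by elim: r => [|r IH] //=; rewrite kdiff0 scaler0 IH subr0. Qed.

Lemma cochain_ones_eq0 r i n (c : koszul V r) : (forall v, L (n + i) v -> v = 0) ->
  cochain L (fun=> 1%N) i n c -> c = 0.
Proof.
elim: r i n c => [|r IH] i n c L0 /=.
  by case: eqP => // i0; rewrite i0 addr0 in L0; apply: L0.
case: c => a b /= [/IH-> // /IH->] //.
by have -> : n + 1 + (i - 1) = n + i by lia.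
Qed.

(** With all exponents equal to one, an element of L_0 is a cocycle of top degree
r and internal degree -r.  Coboundaries in this bidegree have components in
L_(-1) = 0, so such an element lies in N_0. *)
Lemma van_all_frozen y r : stable y L -> stable y N -> (forall v, L (-1) v -> v = 0) ->
  vanishes y r r L N r%:Z (- r%:Z) -> forall v, L 0 v -> N 0 v.
Proof.
move=> sL sN L0 H v Lv.
have [|||e [b [_ fe Lb Nb]]] := H (fun=> 1%N) (top_cochain r v) => //.
- by apply/(cochain_top _ _ _ sL); rewrite addNr.
- by rewrite kdiff_top; apply: cochain0 sN.
have b0 : b = 0.
  apply: cochain_ones_eq0 (cochain_ext fe Lb) => w.
  by rewrite (_ : - r%:Z + (r%:Z - 1) = -1); [exact: L0|lia].
move: Nb; rewrite b0 kdiff0 subr0 => /(cochain_ext fe).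
rewrite (@ktrans_ext _ _ _ _ (fun=> 1%N) _ (fun=> 1%N)); last by move=> j /fe.
by rewrite ktrans_id => /(cochain_top _ _ _ sN); rewrite addNr.
Qed.
End Top.

(** This bounds the regularity of a nonnegatively graded module that is nonzero
in degree 0 from below by 0.  Exponents are frozen one after the other, until
[van_all_frozen] applies. *)
Lemma regularity_nonneg (S : comNzRingType) (V : lmodType S) (L N : int -> set V) y r :
  stable y L -> stable y N -> (forall v, L (-1) v -> v = 0) ->
  (forall i n, 0 <= n + i -> vanishes y r 0 L N i n) -> forall v, L 0 v -> N 0 v.
Proof.
move=> sL sN L0 H.
suff [y' [sL' sN' H']] : exists y', [/\ stable y' L, stable y' N
    & forall i n, 0 <= n + i -> vanishes y' r r L N i n].
  by apply: van_all_frozen sL' sN' L0 (H' _ _ _); rewrite addNr.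
case: r H => [|r] H; first by exists y.
suff: forall f, (f <= r.+1)%N -> exists y', [/\ stable y' L, stable y' N
    & forall i n, 0 <= n + i -> vanishes y' r.+1 f L N i n] by apply.
elim=> [_|f IH fr]; first by exists y.
have [y' [sL' sN' H']] := IH (ltnW fr).
have st M : stable y' M -> stable (prepend (y' r) y') M.
  by case=> M0 MB MY; split=> // n [|j] v Mv; apply: MY.
by exists (prepend (y' r) y'); split; [exact: st|exact: st|apply: van_freeze].
Qed.

(** * Cochains of degree zero *)

Section Iota.
Variables (S : comNzRingType) (V : lmodType S).
(** The cochains of cohomological degree 0 are exactly these. *)
Fixpoint bottom r (v : V) : koszul V r := if r is r'.+1 then (bottom r' v, 0) else v.

Lemma bottomB r : {morph @bottom r : u v / u - v}.
Proof. by elim: r => [|r IH] //= u v; rewrite IH; congr pair; rewrite /= subr0. Qed.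

Lemma bottom0 r : bottom r 0 = 0.
Proof. by rewrite -[X in bottom r X](subrr 0) bottomB subrr. Qed.

Lemma bottomZ r s v : bottom r (s *: v) = s *: bottom r v.
Proof. by elim: r => [|r IH] //=; rewrite IH; congr pair; rewrite /= scaler0. Qed.

Lemma bottom_inj r : injective (bottom r).
Proof. by elim: r => [|r IH] //= u v [/IH]. Qed.

Lemma ktrans_bottom y e e' r v : ktrans y e e' (bottom r v) = bottom r v.
Proof. by elim: r => [|r IH] //=; rewrite IH ktrans0 scaler0. Qed.

Lemma kdiff_bottom y e r v :
  kdiff y e (bottom r v) = 0 <-> forall j, (j < r)%N -> y j ^+ e j *: v = 0.
Proof.
elim: r => [|r IH] /=; first by split.
rewrite kdiff0 subr0 -bottomZ; split=> [[/IH h1 h2] j|h].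
  rewrite ltnS leq_eqVlt => /orP[/eqP->|]; last exact: h1.
  by apply: (@bottom_inj r); rewrite bottom0.
congr pair; last by rewrite h // bottom0.
by apply/IH => j jr; apply: h; apply: ltnW.
Qed.

Lemma cochain_bottom y (L : int -> set V) e r n v : stable y L -> L n v -> cochain L e 0 n (bottom r v).
Proof.
by move=> sL Lv; elim: r => [|r IH] //=; split=> //; apply: cochain0 sL.
Qed.

Lemma cochain_bottomP (L : int -> set V) e r n (c : koszul V r) :
  cochain L e 0 n c -> exists2 v, L n v & c = bottom r v.
Proof.
elim: r n c => [|r IH] n c /=; first by exists c.
case: c => a b /= [/IH[v Lv ->] Lb]; exists v => //.
by rewrite (cochain_neg _ Lb).
Qed.

Lemma cochain_zero e r i n (c : koszul V r) : cochain (@zero_fam S V) e i n c <-> c = 0.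
Proof.
elim: r i n c => [|r IH] i n c /=; first by case: eqP.
by case: c => a b /=; rewrite !IH; split=> [[-> ->]|[-> ->]].
Qed.

Lemma stable_zero_fam y : stable y (@zero_fam S V).
Proof.
by split=> // [n u v -> ->|n j v ->]; [exact: subr0|exact: scaler0].
Qed.
End Iota.

(** * Homogeneous components *)

Section Grading.
Variables (V : zmodType) (P : int -> set V).
Hypothesis gP : is_grading P.

Lemma gP0 n : P n 0. Proof. by case: gP => /(_ n)[]. Qed.
Lemma gPB n u v : P n u -> P n v -> P n (u - v).
Proof. by case: gP => /(_ n)[_ + _ _]; apply. Qed.
Lemma gPN n u : P n u -> P n (- u).
Proof. by rewrite -sub0r; apply: gPB; apply: gP0. Qed.
Lemma gPD n u v : P n u -> P n v -> P n (u + v).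
Proof. by move=> Pu Pv; rewrite -[v]opprK; apply: gPB => //; apply: gPN. Qed.
Lemma gPMn n u k : P n u -> P n (u *+ k).
Proof.
by move=> Pu; elim: k => [|k IH]; [apply: gP0|rewrite mulrS; apply: gPD].
Qed.

(** Normalised decompositions, which [is_grading] makes unique. *)
Definition decomp (x : V) (sf : seq int * (int -> V)) :=
  [/\ uniq sf.1, forall n, P n (sf.2 n), forall n, n \notin sf.1 -> sf.2 n = 0
    & x = \sum_(n <- sf.1) sf.2 n].

Lemma decomp_ex x : exists sf, decomp x sf.
Proof.
case: gP => _ /(_ x)[s [f [Pf ->]]] _.
exists (undup s, fun n => f n *+ count_mem n s); split=> /=.
- exact: undup_uniq.
- by move=> n; apply: gPMn.
- by move=> n; rewrite mem_undup => /count_memPn->.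
- by rewrite -big_undup_iterop_count.
Qed.

Lemma sum_ext (s t : seq int) (f : int -> V) : uniq s -> uniq t ->
  {subset s <= t} -> (forall n, n \notin s -> f n = 0) ->
  \sum_(n <- s) f n = \sum_(n <- t) f n.
Proof.
move=> us ut st f0; rewrite [RHS](bigID (mem s)) /= [X in _ + X]big1 ?addr0.
  rewrite -[RHS]big_filter; apply: perm_big; apply: uniq_perm => //.
    exact: filter_uniq.
  by move=> n; rewrite mem_filter /=; case: (boolP (n \in s)) => //= /st->.
by move=> n; apply: f0.
Qed.

Lemma decomp_uniq x sf sg : decomp x sf -> decomp x sg -> sf.2 =1 sg.2.
Proof.
case: sf sg => [s f] [t g] [/= us Pf f0 xf] [/= ut Pg g0 xg] n.
have [_ _ uP] := gP; pose w := undup (s ++ t).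
have sw : {subset s <= w} by move=> k ks; rewrite mem_undup mem_cat ks.
have tw : {subset t <= w} by move=> k tk; rewrite mem_undup mem_cat tk orbT.
have [nw|nw] := boolP (n \in w); last first.
  by rewrite f0 ?g0 //; apply: contra nw; first [exact: tw|exact: sw].
apply/eqP; rewrite -subr_eq0; apply/eqP.
apply: (uP w (fun k => f k - g k)) => //; first exact: undup_uniq.
  by move=> k; apply: gPB.
rewrite big_split /= sumrN.
by rewrite -(sum_ext us (undup_uniq _) sw f0) -(sum_ext ut (undup_uniq _) tw g0) -xf -xg subrr.
Qed.

Definition gproj_ex := choice decomp_ex.
Definition gproj n x := (projT1 gproj_ex x).2 n.
Definition gsupp x := (projT1 gproj_ex x).1.

Lemma gprojP x : decomp x (gsupp x, gproj^~ x).
Proof. by rewrite /gsupp /gproj; case: gproj_ex => f /= /(_ x); case: (f x). Qed.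

Lemma gprojE x s f : uniq s -> (forall n, P n (f n)) ->
  (forall n, n \notin s -> f n = 0) -> x = \sum_(n <- s) f n ->
  forall n, gproj n x = f n.
Proof.
move=> us Pf f0 xf n.
by have /= -> // := @decomp_uniq x (gsupp x, gproj^~ x) (s, f) (gprojP x).
Qed.

Lemma gproj_in n x : P n (gproj n x).
Proof. by have [] := gprojP x. Qed.

Lemma gproj_sum x : x = \sum_(n <- gsupp x) gproj n x.
Proof. by have [] := gprojP x. Qed.

Lemma gprojB n : {morph gproj n : u v / u - v}.
Proof.
move=> u v; pose w := undup (gsupp u ++ gsupp v).
have [us _ u0 ue] := gprojP u; have [vs _ v0 ve] := gprojP v.
have sw : {subset gsupp u <= w} by move=> k ks; rewrite mem_undup mem_cat ks.
have tw : {subset gsupp v <= w} by move=> k tk; rewrite mem_undup mem_cat tk orbT.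
apply: (@gprojE _ w (fun k => gproj k u - gproj k v)).
- exact: undup_uniq.
- by move=> k; apply: gPB; apply: gproj_in.
- by move=> k kw; rewrite [gproj k u]u0 ?[gproj k v]v0 ?subr0 //; apply: contra kw; first [exact: tw|exact: sw].
rewrite big_split /= sumrN.
by rewrite -(sum_ext us (undup_uniq _) sw u0) -(sum_ext vs (undup_uniq _) tw v0) -ue -ve.
Qed.

Lemma gproj0 n : gproj n 0 = 0.
Proof. by rewrite -[X in gproj n X](subrr 0) gprojB subrr. Qed.
Lemma gprojN n u : gproj n (- u) = - gproj n u.
Proof. by rewrite -[in LHS]sub0r gprojB gproj0 sub0r. Qed.
Lemma gprojD n : {morph gproj n : u v / u + v}.
Proof. by move=> u v; rewrite -[v in LHS]opprK gprojB gprojN opprK. Qed.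
Lemma gproj_bigsum n (I : Type) (r : seq I) (f : I -> V) :
  gproj n (\sum_(i <- r) f i) = \sum_(i <- r) gproj n (f i).
Proof. by apply: (big_morph (gproj n)); [exact: gprojD|exact: gproj0]. Qed.

Lemma gproj_hom m n x : P n x -> gproj m x = if m == n then x else 0.
Proof.
move=> Px; apply: (@gprojE _ [:: n] (fun m => if m == n then x else 0)) => //.
- by move=> k; case: eqP => [->//|_]; apply: gP0.
- by move=> k; rewrite inE => /negPf->.
- by rewrite big_seq1 eqxx.
Qed.
End Grading.

(** Homogeneous maps commute with taking components.  It serves to choose
homogeneous preimages along maps of graded modules. *)
Lemma gproj_map (V W : zmodType) (P : int -> set V) (Q : int -> set W)
    (gP : is_grading P) (gQ : is_grading Q) (f : V -> W) d :
  {morph f : u v / u - v} -> (forall n x, P n x -> Q (n + d) (f x)) ->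
  forall n x, gproj gQ n (f x) = f (gproj gP (n - d) x).
Proof.
move=> fB fg n x.
have f0 : f 0 = 0 by rewrite -[X in f X](subrr 0) fB subrr.
have fD : {morph f : u v / u + v}.
  by move=> u v; rewrite -[v in LHS]opprK fB -[- v]sub0r fB f0 sub0r opprK.
have [us _ u0 ue] := gprojP gP x.
apply: (@gprojE _ _ gQ _ [seq k + d | k <- gsupp gP x] (fun k => f (gproj gP (k - d) x))).
- by rewrite map_inj_uniq //; apply: addIr.
- by move=> k; have := fg _ _ (gproj_in gP (k - d) x); rewrite subrK.
- move=> k kn; rewrite [gproj _ _ _]u0 // /=; apply: contra kn => kn.
  by apply/mapP; exists (k - d) => //; rewrite subrK.
rewrite big_map; under eq_bigr do rewrite addrK.
by rewrite -(big_morph f fD f0) -ue.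
Qed.

(** * Division in graded injective modules *)

Section Linear.
Variables (R : nzRingType) (U V : lmodType R) (f : U -> V) (fL : linear f).
(** The phantom proof lets a bare function carry a canonical linear structure. *)
Definition linear_of (_ : linear f) := f.
HB.instance Definition _ := GRing.isLinear.Build R U V *:%R (linear_of fL) fL.
Definition linear_fun : {linear U -> V} := linear_of fL.
End Linear.

Section HomIdeal.
Variable S : gradedRing.

Definition component n x := gproj (gr_grading S) n x.

Lemma component_homogM m (a x : S) n : gr_piece m a ->
  component n (a * x) = a * component (n - m) x.
Proof.
move=> Sa; apply: (gproj_map (gr_grading S) (gr_grading S) (f := *%R a)).
  by move=> u v; rewrite mulrBr.
by move=> k u Su; rewrite addrC; apply: gr_mul.
Qed.

(** Homogeneity is expressed by closure under components. *)
Record homIdeal := HomIdeal {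
  hi_set :> S -> Prop;
  hi_ideal : is_ideal hi_set;
  hi_proj : forall n x, hi_set x -> hi_set (component n x) }.

Variable I : homIdeal.

Definition hi_pred : {pred S^o} := fun x => `[< I x >].

Lemma hi_submod : submod_closed hi_pred.
Proof.
split; first by apply/asboolP; apply: is_ideal0 (hi_ideal I).
by move=> a u v /asboolP Iu /asboolP Iv; apply/asboolP; apply: (hi_ideal I).2.
Qed.

HB.instance Definition _ := GRing.isSubmodClosed.Build S S^o hi_pred hi_submod.

Record hi_type := HiElt { hi_val : S^o; _ : hi_val \in hi_pred }.
HB.instance Definition _ := [isSub for hi_val].
HB.instance Definition _ := [Choice of hi_type by <:].
HB.instance Definition _ := [SubChoice_isSubLmodule of hi_type by <:].

Lemma hi_valP (x : hi_type) : I (val x).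
Proof. by case: x => x /= /asboolP. Qed.

Lemma shift_grading d : is_grading (fun n => @gr_piece S (n - d)).
Proof.
have [gB gE gU] := gr_grading S; split=> [n|x|s f us Pf sf n ns].
- exact: gB.
- have [s [f [Pf ->]]] := gE x.
  exists [seq k + d | k <- s], (fun n => f (n - d)); split=> [n|]; first exact: Pf.
  by rewrite big_map; apply: eq_bigr => k _; rewrite addrK.
have := gU [seq k - d | k <- s] (fun k => f (k + d)).
rewrite (map_inj_uniq (@addIr _ _)) big_map => /(_ us).
under eq_bigr do rewrite subrK.
move=> /(_ _ sf (n - d)); rewrite subrK; apply.
  by move=> k; have := Pf (k + d); rewrite addrK.
by apply/mapP; exists n.
Qed.

Definition hi_piece d n : set hi_type := [set x | gr_piece (n - d) (val x)].

Lemma hi_grading d : is_grading (hi_piece d).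
Proof.
have [gB gE gU] := shift_grading d; split=> [n|x|s f us Pf sf n ns].
- by split=> [|x y]; rewrite /hi_piece /= ?raddf0 ?raddfB; apply gB.
- have Ix n : component n (val x) \in hi_pred.
    by apply/asboolP; apply: hi_proj; apply: hi_valP.
  exists [seq k + d | k <- gsupp (gr_grading S) (val x)], (fun n => HiElt (Ix (n - d))).
  split=> [n|]; first exact: gproj_in.
  apply: val_inj; rewrite raddf_sum /= big_map.
  under eq_bigr do rewrite addrK; exact: gproj_sum.
- apply: val_inj; rewrite raddf0; apply: (gU s (fun k => val (f k))) => //.
  by rewrite -(raddf_sum val) sf raddf0.
Qed.

Lemma hi_scale d m n (a : S) (x : hi_type) :
  gr_piece m a -> hi_piece d n x -> hi_piece d (m + n) (a *: x).
Proof. by move=> Sa Sx; rewrite /hi_piece /= -addrA; apply: gr_mul. Qed.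

(** The ideal I as a graded module, with degrees shifted by d. *)
Definition hi_module d : gradedModule S :=
  @GradedModule S hi_type (hi_piece d) (hi_grading d) (@hi_scale d).

Lemma shift_scale d m n (a x : S) : gr_piece m a -> gr_piece (n - d) x ->
  gr_piece (m + n - d) (a * x).
Proof. by move=> Sa Sx; rewrite -addrA; apply: gr_mul. Qed.

Definition shift_module d : gradedModule S :=
  @GradedModule S S^o _ (shift_grading d) (@shift_scale d).

End HomIdeal.

(** Let w annihilate, modulo a, only elements that kill v.  On the ideal
(w) + a, the map sending w t + s to t v for s in a is then well defined; it
extends to the whole ring, and the image v' of 1 satisfies w v' = v and
a v' = 0. *)
Section Divide.
Variables (S : gradedRing) (E : gradedModule S).
Hypothesis injE : graded_injective E.
Variables (a : homIdeal S) (w : S) (k n : int) (v : E).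
Hypotheses (Sw : gr_piece k w) (Ev : gm_piece n v).
Hypothesis wv : forall s, a (w * s) -> s *: v = 0.

Let I0 : set S := [set s | exists t, a (s - w * t)].

Let idI0 : is_ideal I0.
Proof.
have ida := hi_ideal a; split=> [|c x y [s sx] [t ty]].
  by exists 0; rewrite mulr0 subr0; apply: is_ideal0 ida.
exists (c * s + t).
rewrite mulrDr mulrCA opprD addrACA -mulrBr; exact: ida.2.
Qed.

Let projI0 l x : I0 x -> I0 (component l x).
Proof.
move=> [t xt]; exists (component (l - k) t).
by rewrite -component_homogM // -gprojB; apply: hi_proj.
Qed.

Let I := HomIdeal idI0 projI0.

Lemma injective_divide :
  exists2 v' : E, gm_piece (n - k) v' & w *: v' = v /\ forall s, a s -> s *: v' = 0.
Proof.
have ida := hi_ideal a.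
have /choice[q qP] (x : hi_type I) : exists t, a (val x - w * t) by apply: hi_valP x.
(* the choice of t with x - w t in a does not affect t v *)
have q_uniq (x : hi_type I) t : a (val x - w * t) -> q x *: v = t *: v.
  move=> xt; apply/eqP; rewrite -subr_eq0 -scalerBl; apply/eqP/wv.
  by rewrite mulrBr -[w * q x](subrK (val x)) -opprB -addrA; apply: (is_idealD ida);
    rewrite // -sub0r; apply: (is_idealB ida) => //; apply: is_ideal0 ida.
have gL : linear (fun x => q x *: v).
  move=> c x y /=; rewrite (q_uniq _ (c * q x + q y)) ?scalerDl ?scalerA //.
  rewrite raddfD /= mulrDr mulrCA opprD addrACA -mulrBr; apply: ida.2; exact: qP.
have vL : linear (val : hi_type I -> S^o) by move=> c x y; rewrite linearP.
pose M := hi_module I (n - k); pose N := shift_module S (n - k).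
have [|||h [hg hE]] := injE (M := M) (N := N) (f := linear_fun vL) (g := linear_fun gL).
- by move=> m x.
- exact: val_inj.
- move=> m x /= Sx; rewrite /linear_fun /linear_of /=.
  have -> : q x *: v = component (m - n) (q x) *: v.
    apply: q_uniq; have /(hi_proj (m - (n - k))) := qP x.
    have e : component (m - (n - k)) (val x) = val x.
      by rewrite /component (gproj_hom (gr_grading S) _ Sx) eqxx.
    rewrite [component _ _](gprojB (gr_grading S)) -!/(component _ _) e (component_homogM _ _ Sw).
    by congr (a (_ - _ * component _ _)); lia.
  by rewrite -[m](subrK n); apply: gm_scale => //; rewrite addrK; apply: gproj_in.
exists (h 1).
  by apply: hg; rewrite /= subrr; apply: gr_one.
have hI s : I0 s -> exists x : hi_type I, val x = s.
  by move=> /asboolP Is; exists (HiElt (Is : s \in hi_pred I)).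
have homotopy (s : S) : s *: h 1 = h (s : S^o) by rewrite -linearZ /= -[_ *: _]/(s * 1) mulr1.
have hq s t : a (s - w * t) -> s *: h 1 = t *: v.
  move=> st; have [|x xs] := hI s; first by exists t.
  have hEx : h (val x) = q x *: v := hE x.
  by rewrite homotopy -xs hEx; apply: q_uniq; rewrite xs.
split.
  by rewrite (hq _ 1) ?scale1r // mulr1 subrr; apply: is_ideal0 ida.
by move=> s sa; rewrite (hq _ 0) ?scale0r // mulr0 subr0.
Qed.
End Divide.

(** * Acyclicity of graded injective modules *)

Lemma span_in (A : comNzRingType) (X : set A) : X `<=` ideal_span X.
Proof. by move=> x Xx J [_]; apply. Qed.

Lemma span_min (A : comNzRingType) (X J : set A) : is_ideal J -> X `<=` J ->
  ideal_span X `<=` J.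
Proof. by move=> idJ XJ x; apply. Qed.

Lemma span_ideal (A : comNzRingType) (X : set A) : is_ideal (ideal_span X).
Proof.
split=> [J [idJ _]|a x y sx sy J [idJ XJ]]; first exact: is_ideal0.
by apply: idJ.2; [apply: sx|apply: sy].
Qed.

(** The colons (a : x^q) form an ascending chain, whose union is finitely
generated. *)
Lemma noetherian_colon (A : comNzRingType) (a : set A) (x : A) :
  noetherian A -> is_ideal a ->
  exists m, forall q s, a (x ^+ q * s) -> a (x ^+ m * s).
Proof.
move=> nA ida; have up m q s : (m <= q)%N -> a (x ^+ m * s) -> a (x ^+ q * s).
  by move=> mq; rewrite -(subnK mq) exprD -mulrA; apply: (is_idealM ida).
have [|l lE] := nA [set s | exists q, a (x ^+ q * s)].
  split=> [|c s t [q sq] [p tp]]; first by exists 0%N; rewrite mulr0; apply: is_ideal0 ida.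
  exists (maxn q p); rewrite mulrDr mulrCA; apply: ida.2.
    by apply: (up _ _ _ _ sq); apply: leq_maxl.
  by apply: (up _ _ _ _ tp); apply: leq_maxr.
have [m ml] : exists m, forall t, t \in l -> a (x ^+ m * t).
  have: forall t, t \in l -> exists q, a (x ^+ q * t).
    move=> t tl; suff: [set s | exists q, a (x ^+ q * s)] t by [].
    by rewrite lE; apply: span_in.
  elim: l {lE} => [|t l IH] h; first by exists 0%N.
  have [m hm] := IH (fun u ul => h u (mem_behead (s := t :: l) ul)).
  have [q hq] := h t (mem_head _ _).
  exists (maxn m q) => u; rewrite inE => /orP[/eqP->|/hm hu].
    by apply: (up _ _ _ _ hq); apply: leq_maxr.
  by apply: (up _ _ _ _ hu); apply: leq_maxl.
exists m => q s sq.
have: [set s | exists q, a (x ^+ q * s)] s by exists q.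
rewrite lE; apply: (@span_min _ _ [set u | a (x ^+ m * u)]) => [|t /ml //].
split=> [|c u v]; first by rewrite /= mulr0; apply: is_ideal0 ida.
by rewrite /= mulrDr mulrCA; apply: ida.2.
Qed.

Lemma frozen0 e : frozen 0 e. Proof. by []. Qed.

Section InjVan.
Variables (S : gradedRing) (E : gradedModule S) (y : nat -> S).
Hypotheses (nS : noetherian S) (injE : graded_injective E).
Hypothesis y1 : forall j, gr_piece 1 (y j).

Lemma gr_piece_exp j k : gr_piece k%:Z (y j ^+ k).
Proof.
elim: k => [|k IH]; first by rewrite expr0; apply: gr_one.
by rewrite exprS -[k.+1]add1n PoszD; apply: gr_mul.
Qed.

Lemma gm_stable (M : gradedModule S) : stable y (@gm_piece S M).
Proof.
have [gB _ _] := gm_grading M.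
by split=> [n|n|n j v Mv]; [case: (gB n)|case: (gB n)|rewrite addrC; exact: gm_scale].
Qed.

Section PowerIdeal.
Variables (r : nat) (e : nat -> nat).

Definition pow_set : set S := [set s | exists c : nat -> S, s = \sum_(j < r) c j * y j ^+ e j].

Lemma pow_ideal : is_ideal pow_set.
Proof.
split=> [|a u v [c ->] [d ->]].
  by exists (fun=> 0); rewrite big1 // => j _; rewrite mul0r.
exists (fun j => a * c j + d j); rewrite mulr_sumr -big_split /=.
by apply: eq_bigr => j _; rewrite mulrDl mulrA.
Qed.

Lemma pow_proj n x : pow_set x -> pow_set (component n x).
Proof.
move=> [c ->]; exists (fun j => component (n - (e j)%:Z) (c j)).
rewrite [component _ _]gproj_bigsum; apply: eq_bigr => j _.
by rewrite mulrC -/(component _ _) (component_homogM _ _ (gr_piece_exp _ _)) mulrC.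
Qed.

Definition powI := HomIdeal pow_ideal pow_proj.
End PowerIdeal.

(** In the submodule of E killed by the ideal a of the powers [y j ^+ e j], j < r,
multiplication by y_r becomes surjective after inverting y_r.  The exponent m is
one with (a : y_r^(m+q)) = (a : y_r^m); it is what makes [injective_divide]
applicable. *)
Lemma injective_divide_pow r e q n v : gm_piece n v ->
  (forall j, (j < r)%N -> y j ^+ e j *: v = 0) ->
  exists m (v' : E), [/\ gm_piece (n - q%:Z) v', y r ^+ (m + q) *: v' = y r ^+ m *: v
    & forall j, (j < r)%N -> y j ^+ e j *: v' = 0].
Proof.
move=> Ev kill; have [m mP] := noetherian_colon (y r) nS (pow_ideal r e).
have killa s : pow_set r e s -> s *: v = 0.
  by move=> [c ->]; rewrite scaler_suml big1 // => j _; rewrite -scalerA kill ?scaler0.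
have Sw := gr_piece_exp r (m + q).
have Ev' : gm_piece (n + m%:Z) (y r ^+ m *: v).
  by rewrite addrC; apply: gm_scale => //; apply: gr_piece_exp.
have [|v' Ev'' [wv av]] := injective_divide injE (a := powI r e) Sw Ev'.
  by move=> s /= /mP sm; rewrite scalerA mulrC; apply: killa.
exists m, v'; split=> //; first by move: Ev''; rewrite PoszD opprD addrA addrK.
move=> j jr; apply: av => /=; exists (fun k => (k == j)%:R).
rewrite (bigD1 (Ordinal jr)) //= eqxx mul1r big1 ?addr0 // => k kj.
by rewrite (_ : (_ == _) = false) ?mul0r //; apply/negbTE; apply: contra kj => /eqP kj; apply/eqP/val_inj.
Qed.

(** Induction on r: a cocycle is a pair (a, b), and a may be taken to be zero
by induction.  Then b is a cocycle of degree i-1 on r elements.  It bounds by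
induction if i > 1; if i = 1 it is an element killed by powers of the first r
elements, and it is divisible by y_r within such elements. *)
Lemma injective_vanishes r i n : 1 <= i -> vanishes y r 0 (@gm_piece S E) (@zero_fam S E) i n.
Proof.
have sE := gm_stable E.
elim: r i n => [|r IH] i n i1 e c _.
  move=> /= c0 _; apply: cobounds0 => //; move: c0 => /=.
  by case: eqP => // i0; move: i1; rewrite i0.
case: c => a b [/= La Lb] [/cochain_zero da /cochain_zero /eqP]; rewrite subr_eq0 => /eqP dab.
have [|e1 [a' [le1 _ La' /cochain_zero /eqP]]] := IH i n i1 e a (frozen0 e) La.
  by apply/cochain_zero.
rewrite subr_eq0 => /eqP aa'.
pose c1 : koszul E r.+1 := ktrans y e e1 ((a, b) : koszul E r.+1).
have Lc1 : cochain (@gm_piece S E) e1 i n c1 by apply: (cochain_ktrans sE le1).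
(* the first component of the cocycle is cleared by (a', 0) *)
pose b1 := c1.2 - y r ^+ e1 r *: a'.
have db1 : kdiff y e1 b1 = 0.
  rewrite /b1 /= kdiffB !kdiffZ -ktrans_kdiff // -dab ktransZ scalerA -exprD subnK // aa' subrr //.
have Lb1 : cochain (@gm_piece S E) e1 (i - 1) (n + (e1 r)%:Z) b1.
  by apply: (cochainB sE); [exact: Lc1.2|exact: cochain_scaleX].
suff [e2 [[p s] [le2 _ Lps /cochain_zero N2]]] :
    cobounds y 0 (@gm_piece S E) (@zero_fam S E) e1 i n ((0, b1) : koszul E r.+1).
  exists e2, ((p, s) + ktrans y e1 e2 ((a', 0) : koszul E r.+1)); split=> //.
  - exact: exp_le_trans le2.
  - apply: (cochainD sE) => //; apply: (cochain_ktrans sE le2); split=> //=.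
    exact: cochain0 sE.
  apply/cochain_zero; rewrite -[RHS]N2 kdiffD -ktrans_kdiff // opprD addrA addrAC.
  rewrite -(ktrans_ktrans _ _ le1 le2) -ktransB; congr (ktrans _ _ _ _ - _).
  by congr pair; rewrite /= ?aa' ?subrr // kdiff0 subr0.
(* i = 1 is the step where injectivity, rather than induction, is used *)
have [i2|i2] : 1 <= i - 1 \/ i = 1 by lia.
  have [|e2 [b2 [le2 _ Lb2 /cochain_zero /eqP]]] := IH (i - 1) _ i2 e1 b1 (frozen0 e1) Lb1.
    by apply/cochain_zero.
  rewrite subr_eq0 => /eqP bb2.
  exists e2, (0, - (y r ^+ (e2 r - e1 r) *: b2)); split=> //=.
    split; first exact: cochain0 sE.
    apply: (cochainN sE).
    have -> : n + (e2 r)%:Z = n + (e1 r)%:Z + (e2 r - e1 r)%:Z.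
      by have := le2 r; lia.
    exact: cochain_scaleX.
  split; apply/cochain_zero; first by rewrite ktrans0 kdiff0 subr0.
  by rewrite scaler0 sub0r opprK kdiffN kdiffZ bb2 subrr.
have {}Lb1 : cochain (@gm_piece S E) e1 0 (n + (e1 r)%:Z) b1.
  by move: Lb1; rewrite i2 subrr.
have [v Ev b1v] := cochain_bottomP Lb1.
move: db1; rewrite b1v => /kdiff_bottom kill.
have [m [v' [Ev' vv' kill']]] := injective_divide_pow (e1 r) Ev kill.
rewrite addrK in Ev'.
pose e2 := update_exp e1 r (m + e1 r).
have le2 : exp_le e1 e2.
  by move=> j; rewrite /e2 /update_exp; case: eqP => [->|//]; apply: leq_addl.
exists e2, (bottom r v', 0); split=> //=.
  rewrite i2 subrr; split; first by apply: cochain_bottom Ev'; exact: sE.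
  exact: cochain0 sE.
split; apply/cochain_zero.
  rewrite ktrans0 sub0r (_ : kdiff _ _ _ = 0) ?oppr0 //; apply/kdiff_bottom => j jr.
  by rewrite /e2 update_exp_lt // kill'.
rewrite kdiff0 subr0 ktrans_bottom /e2 update_exp_eq addnK -!bottomZ vv' subrr //.
Qed.
End InjVan.

(** * Local cohomology is Koszul cohomology *)

Section LocalCohomology.
Variables (S : gradedRing) (M : gradedModule S) (E : graded_injective_resolution M).
Variables (y : nat -> S) (r : nat).
Hypotheses (nS : noetherian S) (y1 : forall j, gr_piece 1 (y j)).
Hypothesis torP : forall (W : gradedModule S) (x : W),
  torsion x <-> exists k, forall j, (j < r)%N -> y j ^+ k *: x = 0.

Notation vanishes0 L i n := (vanishes y r 0 L (@zero_fam _ _) i n).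

(** The graded cycles of the resolution; they are its successive syzygies, and
the first one is M. *)
Definition res_cycles (k : nat) (n : int) : set (E k) := [set x | gm_piece n x /\ res_d E k x = 0].
Arguments res_cycles k n _ : clear implicits.

Lemma stable_cycles k : stable y (res_cycles k).
Proof.
have [E0 EB EY] := gm_stable y1 (E k).
split=> [n|n u v [Eu du] [Ev dv]|n j v [Ev dv]]; split.
- exact: E0.
- exact: raddf0.
- exact: EB.
- by rewrite raddfB /= du dv subrr.
- exact: EY.
- by rewrite linearZ /= dv scaler0.
Qed.

Lemma res_d_proj k n (x : E k) :
  gproj (gm_grading (E k.+1)) n (res_d E k x) = res_d E k (gproj (gm_grading (E k)) n x).
Proof.
rewrite (gproj_map (gm_grading (E k)) (gm_grading (E k.+1)) (d := 0)) ?subr0 //.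
  exact: raddfB.
by move=> m v Ev; rewrite addr0; apply: res_d_graded.
Qed.

Lemma res_aug_proj n (x : M) :
  gproj (gm_grading (E 0%N)) n (res_aug E x) = res_aug E (gproj (gm_grading M) n x).
Proof.
rewrite (gproj_map (gm_grading M) (gm_grading (E 0%N)) (d := 0)) ?subr0 //.
  exact: raddfB.
by move=> m v Ev; rewrite addr0; apply: res_aug_graded.
Qed.

Lemma cycles_lift k n w : res_cycles k.+1 n w -> exists2 v : E k, gm_piece n v & res_d E k v = w.
Proof.
move=> [Ew dw]; have : range (res_d E k) w by rewrite res_exact.
case=> v _ vw; exists (gproj (gm_grading (E k)) n v); first exact: gproj_in.
by rewrite -res_d_proj vw (gproj_hom _ _ Ew) eqxx.
Qed.

Lemma cycles0_lift n w : res_cycles 0 n w -> exists2 v : M, gm_piece n v & res_aug E v = w.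
Proof.
move=> [Ew dw]; have : range (res_aug E) w by rewrite res_exact0.
case=> v _ vw; exists (gproj (gm_grading M) n v); first exact: gproj_in.
by rewrite -res_aug_proj vw (gproj_hom _ _ Ew) eqxx.
Qed.

Lemma res_dd k x : res_d E k.+1 (res_d E k x) = 0.
Proof.
by have : [set z | res_d E k.+1 z = 0] (res_d E k x) by rewrite -res_exact; exists x.
Qed.

Lemma van_res_aug i n : vanishes0 (@gm_piece S M) i n <-> vanishes0 (res_cycles 0) i n.
Proof.
apply: (van_transport (phi := res_aug E)).
- exact: raddfB.
- by move=> j v; rewrite linearZ.
- exact: gm_stable.
- exact: stable_zero_fam.
- move=> m v Mv; split; first exact: res_aug_graded.
  by have : [set z | res_d E 0%N z = 0] (res_aug E v) by rewrite -res_exact0; exists v.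
- move=> m v _; split=> [->|]; first exact: raddf0.
  by move=> h; apply: (@res_aug_inj _ _ E); rewrite raddf0.
- by move=> m w /cycles0_lift[v Mv <-]; exists v => //; apply: subrr.
- by move=> m w ->; apply: (gP0 (gm_grading M)).
Qed.

Lemma van_res_d k i n : vanishes y r 0 (@gm_piece S (E k)) (res_cycles k) i n <-> vanishes0 (res_cycles k.+1) i n.
Proof.
apply: (van_transport (phi := res_d E k)).
- exact: raddfB.
- by move=> j v; rewrite linearZ.
- exact: gm_stable.
- exact: stable_zero_fam.
- by move=> m v Mv; split; [exact: res_d_graded|exact: res_dd].
- by move=> m v Ev; split=> [[]|].
- by move=> m w /cycles_lift[v Mv <-]; exists v => //; apply: subrr.
- by move=> m w [].
Qed.

(** Dimension shifting along 0 -> Z^k -> E^k -> Z^(k+1) -> 0. *)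
Lemma van_cycles_shift k i n : 1 <= i -> vanishes0 (res_cycles k) (i + 1) n <-> vanishes0 (res_cycles k.+1) i n.
Proof.
move=> i1; rewrite -van_res_d.
have sE := gm_stable y1 (E k); have sZ := stable_cycles k.
have s0 := @stable_zero_fam _ (E k) y.
have vE m : 1 <= m -> vanishes0 (@gm_piece S (E k)) m n.
  by apply: injective_vanishes; [|exact: res_inj|].
have Z0 m v : @zero_fam S (E k) m v -> res_cycles k m v.
  by move=> ->; case: sZ.
have ZE m v : res_cycles k m v -> gm_piece m v by case.
split=> h.
  by apply: (van_quo s0 sZ sE Z0 ZE) => //; exact: vE.
apply: (van_sub s0 sZ Z0 ZE); first by rewrite addrK.
by apply: vE; lia.
Qed.

Lemma koszul_map_bottom (W W' : lmodType S) (phi : W -> W') v :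
  {morph phi : u v / u - v} -> koszul_map phi (bottom r v) = bottom r (phi v).
Proof. by move=> phiB; elim: r => [|s IH] //=; rewrite IH (koszul_map0 phiB). Qed.

Lemma cochain_cycles k e i n (c : koszul (E k) r) :
  cochain (res_cycles k) e i n c <-> cochain (@gm_piece S (E k)) e i n c /\ koszul_map (res_d E k) c = 0.
Proof.
elim: r i n c => [|s IH] i n c /=.
  by case: eqP => // _; split=> [->|[]//]; rewrite raddf0.
rewrite !IH; split=> [[[? ->] [? ->]]|[[? ?] [? ?]]]; by [].
Qed.

Lemma kill_torsion (W : gradedModule S) e (v : W) :
  (forall j, (j < r)%N -> y j ^+ e j *: v = 0) -> torsion v.
Proof.
move=> kill; apply/torP; exists (\max_(j < r) e j)%N => j jr.
have /subnK<- : (e j <= \max_(j < r) e j)%N by exact: (leq_bigmax (Ordinal jr)).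
by rewrite exprD -scalerA kill ?scaler0.
Qed.

(** Both sides say that the torsion functor maps E^k onto the torsion of Z^(k+1).
A torsion element x = d b gives the Koszul cocycle of b, with values in Z^k;
writing it as the coboundary of b0 in Z^k means that b - b0 is torsion. *)
Lemma van_cycles1 k n :
  vanishes0 (res_cycles k) 1 n <-> lc_cocycle E k.+1 n `<=` lc_coboundary E k.+1 n.
Proof.
have sE := gm_stable y1 (E k); have sZ := stable_cycles k.
have dB : {morph res_d E k : u v / u - v} by exact: raddfB.
have dY j v : res_d E k (y j *: v) = y j *: res_d E k v by rewrite linearZ.
split=> [v x [/torP[N kill] Ex dx]|h e c _ /cochain_cycles[Lc dc] /cochain_zero kc].
- have [b Eb bx] := cycles_lift (conj Ex dx).
  pose e := fun _ : nat => N.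
  have [||e' [b' [le _ /cochain_bottomP[b0 [Eb0 db0] ->] /cochain_zero]]] :=
      v e (kdiff y e (bottom r b)) (frozen0 e).
  + apply/cochain_cycles; split; first by rewrite -[1]add0r; apply: (cochain_kdiff sE); apply: cochain_bottom Eb; exact: sE.
    by rewrite (koszul_map_kdiff dB dY) (koszul_map_bottom _ dB) bx; apply/kdiff_bottom.
  + by rewrite kdiffK; apply/cochain_zero.
  rewrite ktrans_kdiff // ktrans_bottom -kdiffB -bottomB => /kdiff_bottom kill'.
  exists (b - b0); last by rewrite dB bx db0 subr0.
  by split; [exact: kill_torsion kill'|case: sE => _ + _; apply].
have [|e1 [b1 [le1 _ + /cochain_zero /eqP]]] :=
    injective_vanishes nS (@res_inj _ _ E k) y1 (isT : 1 <= 1 :> int) (frozen0 e) Lc.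
  exact/cochain_zero.
rewrite subrr => /cochain_bottomP[b0 Eb0 ->]; rewrite subr_eq0 => /eqP cb.
(* b0 need not have values in Z^k; it is corrected by a torsion w with d w = d b0 *)
pose z := res_d E k b0.
have [w [/torP[N kw] Ew] wz] : lc_coboundary E k.+1 n z.
  apply: h; split; [|exact: res_d_graded|exact: res_dd].
  apply: (@kill_torsion _ e1); apply/kdiff_bottom.
  by rewrite -(koszul_map_bottom _ dB) -(koszul_map_kdiff dB dY) -cb (koszul_map_ktrans dY) dc ktrans0.
pose e2 j := maxn (e1 j) N.
have le2 : exp_le e1 e2 by move=> j; apply: leq_maxl.
exists e2, (bottom r (b0 - w)); split=> //; first exact: exp_le_trans le2.
  rewrite subrr; apply: cochain_bottom; first exact: sZ.
  by split; [case: sE => _ + _; apply|rewrite dB wz subrr].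
apply/cochain_zero; rewrite -(ktrans_ktrans _ _ le1 le2) cb ktrans_kdiff // ktrans_bottom bottomB kdiffB.
rewrite [kdiff y e2 (bottom r w)](kdiff_bottom _ _ _ _).2 ?subr0 ?subrr // => j jr.
by rewrite /e2 -(subnK (leq_maxr (e1 j) N)) exprD -scalerA kw ?scaler0.
Qed.

Lemma van_cycles0 n : vanishes0 (res_cycles 0) 0 n <-> lc_cocycle E 0 n `<=` lc_coboundary E 0 n.
Proof.
split=> [v x [/torP[N kill] Ex dx]|h e c _ /cochain_bottomP[v Zv ->] /cochain_zero/kdiff_bottom kill].
  pose e := fun _ : nat => N.
  have [||e' [b [_ _ /cochain_neg-> // /cochain_zero]]] := v e (bottom r x) (frozen0 e).
  + by apply: cochain_bottom; [exact: stable_cycles|].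
  + by apply/cochain_zero/kdiff_bottom.
  by rewrite ktrans_bottom kdiff0 subr0 -(bottom0 _ r) => /bottom_inj.
have -> : v = 0.
  by case: Zv => Ev dv; apply: h; split=> //; apply: kill_torsion kill.
rewrite bottom0; apply: cobounds0 => //; first exact: stable_cycles.
exact/cochain_zero.
Qed.

(** The cohomology of the torsion of a graded injective resolution agrees, as
far as vanishing is concerned, with the colimit of Koszul cohomology. *)
Theorem local_cohomology_koszul (i : nat) n :
  ~ lc_nonzero E i n <-> vanishes0 (@gm_piece S M) i%:Z n.
Proof.
rewrite /lc_nonzero notK van_res_aug.
case: i => [|i]; first by rewrite van_cycles0.
rewrite -van_cycles1.
have shift k m : vanishes0 (res_cycles k) m.+1%:Z n <-> vanishes0 (res_cycles (k + m)) 1 n.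
  elim: m k => [|m IH] k; first by rewrite addn0.
  rewrite addnS -addSn -IH -van_cycles_shift; last by lia.
  by rewrite -[m.+2]addn1 PoszD.
by rewrite (shift 0%N).
Qed.
End LocalCohomology.

(** * Torsion is detected by powers of the generators *)

Section TorsionCriterion.
Variables (S : gradedRing) (y : nat -> S) (r N : nat).
Hypothesis y1 : forall j, gr_piece 1 (y j).
Hypothesis ygen : forall (n : int) x, N%:Z < n -> gr_piece n x ->
  exists g : nat -> S, x = \sum_(j < r) y j * g j.

(** Elements all of whose components have degree at least m. *)
Definition high (m : nat) : set S := [set x | forall l : int, l < m%:Z -> component l x = 0].

Lemma componentM l (a b : S) :
  component l (a * b) = \sum_(k <- gsupp (gr_grading S) a) component k a * component (l - k) b.
Proof.
rewrite [in LHS](gproj_sum (gr_grading S) a) mulr_suml [component _ _]gproj_bigsum.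
apply: eq_bigr => k _; apply: component_homogM; exact: gproj_in.
Qed.

Lemma high_mul p q a b : high p a -> high q b -> high (p + q) (a * b).
Proof.
move=> pa qb l lpq; rewrite componentM big1 // => k _.
case: (ltP k p%:Z) => lkp; first by rewrite pa ?mul0r.
by rewrite qb ?mulr0 //; lia.
Qed.

Lemma high_all a : high 0 a.
Proof.
move=> l l0; have := gproj_in (gr_grading S) l a.
by rewrite -/(component l a) gr_nonneg.
Qed.

Lemma high_ideal p : is_ideal (high p).
Proof.
split=> [l _|a u v pu pv l lp]; first exact: gproj0.
rewrite [component _ _]gprojD -!/(component _ _) pv // addr0.
by have := high_mul (high_all a) pu; apply.
Qed.

Lemma irrelevant_exp_high k : ideal_exp (irrelevant_ideal S) k `<=` high k.
Proof.
elim: k => [|k IH]; first by move=> x _; apply: high_all.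
apply: span_min; first exact: high_ideal.
move=> _ [u [v [+ /IH kv ->]]] => u1.
apply: (@high_mul 1 k) kv; move: u u1; apply: span_min; first exact: high_ideal.
move=> x [n n0 nx] l l1; rewrite [LHS](gproj_hom _ _ nx).
by case: eqP => // ln; lia.
Qed.

Lemma exp_irrelevant k j : ideal_exp (irrelevant_ideal S) k (y j ^+ k).
Proof.
elim: k => [|k IH] //; rewrite exprS.
apply: span_in; exists (y j), (y j ^+ k); split=> //.
by apply: span_in; exists 1.
Qed.

(** Induction on the total exponent: an element of high degree is a combination
of the y_j with coefficients of high degree, and each y_j v is killed by smaller
exponents. *)
Lemma high_kill (W : gradedModule S) d (e : nat -> nat) (v : W) : (\sum_(j < r) e j < d)%N ->
  (forall j, (j < r)%N -> y j ^+ e j *: v = 0) ->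
  exists M, forall a, high M a -> a *: v = 0.
Proof.
elim: d e v => // d IH e v; rewrite ltnS => ed kill.
have [v0|e0] := pselect (v = 0); first by exists 0%N => a _; rewrite v0 scaler0.
have epos j : (j < r)%N -> (0 < e j)%N.
  by move=> jr; rewrite lt0n; apply/eqP => ej; apply: e0; have := kill j jr; rewrite ej expr0 scale1r.
have [M MP] : exists M, forall j a, (j < r)%N -> high M a -> a *: (y j *: v) = 0.
  have /choice[f fP] j : exists M, (j < r)%N -> forall a, high M a -> a *: (y j *: v) = 0.
    have [jr|jr] := boolP (j < r)%N; last by exists 0%N.
    have [||M MP] := IH (update_exp e j (e j).-1) (y j *: v).
    - apply: leq_trans ed; rewrite (bigD1 (Ordinal jr)) // [X in (_ < X)%N](bigD1 (Ordinal jr)) //=.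
      rewrite update_exp_eq -addSn prednK ?epos // leq_add2l leq_sum // => i ij.
      by rewrite /update_exp; case: eqP => // ij'; case/eqP: ij; apply: val_inj.
    - move=> i ir; rewrite /update_exp; case: eqP => [->|_].
        by rewrite scalerA -exprSr prednK ?epos // kill.
      by rewrite scalerA mulrC -scalerA kill // scaler0.
    by exists M.
  exists (\max_(j < r) f j)%N => j a jr ha; apply: fP => // l lf; apply: ha.
  by apply: lt_le_trans lf _; rewrite lez_nat; apply: (leq_bigmax (Ordinal jr)).
(* N.+1 more degrees, to write the components of a on the y_j *)
exists (M + N.+1)%N => a ha; rewrite (gproj_sum (gr_grading S) a) scaler_suml big1_seq //=.
move=> l _; rewrite -/(component l a).
have [lM|lM] := ltP l (M + N.+1)%:Z; first by rewrite ha // scale0r.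
have Sl := gproj_in (gr_grading S) l a; rewrite -/(component l a) in Sl.
have [|g ag] := ygen _ Sl; first by lia.
have -> : component l a = \sum_(j < r) y j * component (l - 1) (g j).
  have ee : component l (component l a) = component l a by rewrite [LHS](gproj_hom _ _ Sl) eqxx.
  rewrite -[LHS]ee ag [LHS]gproj_bigsum; apply: eq_bigr => j _.
  by rewrite -/(component _ _) (component_homogM _ _ (y1 j)).
rewrite scaler_suml big1 // => j _; rewrite mulrC -scalerA MP // => m mM.
rewrite [LHS](gproj_hom _ _ (gproj_in _ _ _)).
by case: eqP => // ml; lia.
Qed.

(** Torsion with respect to the irrelevant ideal S_+ may be tested on
elements y_j that generate S_+ in high degrees. *)
Lemma torsionP (W : gradedModule S) (x : W) :
  torsion x <-> exists k, forall j, (j < r)%N -> y j ^+ k *: x = 0.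
Proof.
split=> [[k tor]|[k kill]]; first by exists k => j _; apply: tor; apply: exp_irrelevant.
have [M MP] := high_kill (e := fun=> k) (ltnSn _) kill.
by exists M => a /irrelevant_exp_high/MP.
Qed.
End TorsionCriterion.

(** * Serre vanishing for submodules of the Rees algebra *)

Section Homotopy.
Variables (S : comNzRingType) (V : lmodType S) (y : nat -> S).

(** The contraction showing that y_p^(e_p) acts as zero on the cohomology of
its own Koszul complex. *)
Fixpoint homotopy p r : koszul V r -> koszul V r :=
  match r with
  | 0 => fun=> 0
  | r'.+1 => fun c => if p == r' then (c.2, 0) else (homotopy p c.1, - homotopy p c.2)
  end.

Lemma homotopyP p e r (c : koszul V r) : (p < r)%N ->
  kdiff y e (homotopy p c) + homotopy p (kdiff y e c) = y p ^+ e p *: c.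
Proof.
have hs0 s : @homotopy p s 0 = 0.
  by elim: s => [|s IH] //=; case: eqP => // _; rewrite IH oppr0.
have hsB s : {morph @homotopy p s : u v / u - v}.
  elim: s => [|s IH] u v /=; first by rewrite subr0.
  case: eqP => _; first by congr pair; rewrite /= subr0.
  by rewrite !IH; congr pair; rewrite /= opprD.
have hsZ s a u : @homotopy p s (a *: u) = a *: homotopy p u.
  elim: s u => [|s IH] u /=; first by rewrite scaler0.
  case: eqP => _; first by congr pair; rewrite /= scaler0.
  by rewrite !IH; congr pair; rewrite /= scalerN.
elim: r c => [|r IH] //= [a b]; rewrite ltnS leq_eqVlt => /orP[/eqP pr|pr] /=.
  rewrite pr eqxx /= kdiff0 subr0; congr pair; rewrite /=; last by rewrite addr0.
  by rewrite addrC subrK.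
rewrite (ltn_eqF pr) /=; congr pair; rewrite /=; first exact: IH.
rewrite hsB hsZ opprB kdiffN opprK -[RHS](IH b pr) [RHS]addrC.
by rewrite [LHS]addrC addrA subrK.
Qed.

Lemma homotopy_cochain (L : int -> set V) p e r i n (c : koszul V r) : stable y L -> (p < r)%N ->
  cochain L e i n c -> cochain L e (i - 1) (n + (e p)%:Z) (homotopy p c).
Proof.
move=> sL; elim: r i n c => [|r IH] //= i n [a b]; rewrite ltnS leq_eqVlt.
move=> /orP[/eqP->|pr] [La Lb] /=.
  by rewrite eqxx; split=> //=; apply: cochain0 sL.
rewrite (ltn_eqF pr) /=; split; first exact: IH.
by apply: (cochainN sL); rewrite [n + _ + _]addrAC; apply: IH.
Qed.

Lemma koszul_map_scale a r (c : koszul V r) : koszul_map (fun v => a *: v) c = a *: c.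
Proof. by elim: r c => [|r IH] //= [u v]; rewrite !IH. Qed.

End Homotopy.

Section ReesVal.
Variables (A : comNzRingType) (F : filtration A).
Implicit Types p q : rees_type F.
Lemma rees_val0 : rees_val (0 : rees_type F) = 0. Proof. exact: (rmorph0 val). Qed.
Lemma rees_valD p q : rees_val (p + q) = rees_val p + rees_val q.
Proof. exact: (rmorphD val). Qed.
Lemma rees_valB p q : rees_val (p - q) = rees_val p - rees_val q.
Proof. exact: (rmorphB val). Qed.
Lemma rees_valM p q : rees_val (p * q) = rees_val p * rees_val q.
Proof. exact: (rmorphM val). Qed.
End ReesVal.

Section Families.
Variables (A : comNzRingType) (F : filtration A) (y : nat -> A) (r K : nat).
Hypothesis nR : noetherian (rees_type F).
Hypothesis y1 : forall j, F 1%N (y j).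
Hypothesis ygen : forall n x, (K <= n)%N -> F n.+1 x ->
  exists2 b : nat -> A, (forall j, F n (b j)) & x = \sum_(j < r) y j * b j.

Notation family := (int -> set A^o).

(** The Rees algebra, by its homogeneous pieces in A; it vanishes in negative
degrees. *)
Definition rees_fam : family := fun n => if n is Posz k then F k : set A else [set 0].

(** A graded submodule of the Rees algebra, by its pieces.  All modules for which
Serre vanishing is needed are quotients of two of these. *)
Record rees_submod (L : family) : Prop := ReesSubmod {
  submod0 : forall n, L n 0;
  submodB : forall n u v, L n u -> L n v -> L n (u - v);
  submodR : forall n v, L n v -> rees_fam n v;
  submodM : forall (k : nat) n a v, F k a -> L n v -> L (k%:Z + n) (a * v) }.

Lemma submod_stable L : rees_submod L -> stable y L.
Proof.
move=> gL; split; [exact: submod0|exact: submodB|].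
by move=> n j v Lv; rewrite addrC; apply: (submodM gL (k := 1%N)).
Qed.

Lemma submodD L n u v : rees_submod L -> L n u -> L n v -> L n (u + v).
Proof.
move=> gL Lu Lv; rewrite -[v]opprK; apply: submodB => //.
by rewrite -sub0r; apply: submodB => //; apply: submod0.
Qed.

Lemma submod_sum L n (I : Type) (s : seq I) (f : I -> A) : rees_submod L ->
  (forall i, L n (f i)) -> L n (\sum_(i <- s) f i).
Proof.
move=> gL Lf; elim/big_ind: _ => //; first exact: submod0.
by move=> u v; apply: submodD.
Qed.

Lemma rees_fam_submod : rees_submod rees_fam.
Proof.
split=> [[n|n]|[n|n] u v|[n|n] v|k [n|n] a v] //=.
- exact: is_ideal0 (filt_ideal F n).
- exact: (is_idealB (filt_ideal F n)).
- by move=> -> ->; rewrite subr0.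
- by move=> Fa Fv; apply: filtM_elt.
move=> Fa ->; rewrite mulr0; case: (k%:Z + _) => [m|m] //=.
exact: is_ideal0 (filt_ideal F m).
Qed.

Lemma zero_fam_submod : rees_submod (@zero_fam A A^o).
Proof.
split=> //= [n u v -> ->|[n|n] v ->|k n a v _ ->] //=; rewrite ?subr0 ?mulr0 //.
exact: is_ideal0 (filt_ideal F n).
Qed.

(** A homogeneous ideal of the Rees algebra has finitely many generators, of
bounded degree D.  In degree m > D + K all coefficients on the generators have
degree greater than K, hence are themselves combinations of the y_j. *)
Lemma submod_fg L : rees_submod L -> exists n1 : nat, forall (n : int) v, n1%:Z <= n -> L n v ->
  exists2 b : nat -> A, (forall j, L (n - 1) (b j)) & v = \sum_(j < r) y j * b j.
Proof.
move=> gL.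
have [|l lE] := nR (I := [set p : rees_type F | forall k : nat, L k%:Z (rees_val p)`_k]).
  split=> [k|a u v Lu Lv k]; first by rewrite rees_val0 coef0; apply: submod0.
  rewrite rees_valD rees_valM coefD coefM; apply: submodD => //; apply: submod_sum => // i.
  have := submodM gL (k := i) (n := (k - i)%N) _ (Lu (k - i)%N).
  rewrite -PoszD subnKC; last by rewrite -ltnS.
  by apply; apply/rees_predP; case: (a).
pose D := (\max_(t <- l) size (rees_val t))%N.
pose dec (m : nat) v := exists2 b : nat -> A, (forall j, L (m%:Z - 1) (b j))
   & v = \sum_(j < r) y j * b j.
have dec0 m : dec m 0.
  by exists (fun=> 0) => [j|]; [exact: submod0|rewrite big1 // => j _; rewrite mulr0].
have decD m u v : dec m u -> dec m v -> dec m (u + v).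
  move=> [b Lb ->] [c Lc ->]; exists (fun j => b j + c j); first by move=> j; apply: submodD.
  by rewrite -big_split; apply: eq_bigr => j _; rewrite mulrDr.
(* multiplying by all a of complementary degree makes this condition an ideal *)
pose J : set (rees_type F) := [set p : rees_type F | forall m k a, (D + K.+1 <= m)%N -> (k <= m)%N ->
  F (m - k)%N a -> dec m (a * (rees_val p)`_k)].
have idJ : is_ideal J.
  split=> [m k a _ _ _|c u v Ju Jv m k a mD km Fa]; first by rewrite rees_val0 coef0 mulr0.
  rewrite rees_valD rees_valM coefD coefM mulrDr; apply: (decD); last exact: Jv.
  rewrite mulr_sumr; apply: (big_ind (dec m)) => [||i _]; [exact: dec0|by move=> ? ?; apply: decD|].
  rewrite mulrA; apply: Ju => //; first by apply: leq_trans km; apply: leq_subr.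
  have -> : (m - (k - i) = (m - k) + i)%N by have := ltn_ord i; lia.
  by apply: filtM_elt => //; apply/rees_predP; case: (c).
have lJ : [set` l] `<=` J.
  move=> t tl m k a mD km Fa.
  have [kD|kD] := ltnP k D; last first.
    rewrite nth_default ?mulr0 //; apply: (leq_trans _ kD).
    by apply: (@leq_bigmax_seq _ _ _ (fun t => size (rees_val t))).
  have Lt : L k%:Z (rees_val t)`_k.
    suff: [set p : rees_type F | forall k : nat, L k%:Z (rees_val p)`_k] t by apply.
    by rewrite lE; apply: span_in.
  have [n nE] : exists n, (m - k = n.+1)%N by exists (m - k).-1; lia.
  rewrite nE in Fa; have [|b Fb ->] := ygen _ Fa; first by lia.
  exists (fun j => b j * (rees_val t)`_k); last first.
    by rewrite mulr_suml; apply: eq_bigr => j _; rewrite mulrA.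
  move=> j; have := submodM gL (Fb j) Lt.
  by rewrite (_ : n%:Z + k%:Z = m%:Z - 1) //; lia.
exists (D + K.+1)%N => -[n|n] v //; rewrite lez_nat => nD Lv.
have Fp : (v *: 'X^n : {poly A}) \in rees_pred F.
  apply/rees_predP => k; rewrite coefZ coefXn; case: eqP => [->|_].
    by rewrite mulr1; apply: (submodR gL (n := n)).
  by rewrite mulr0; apply: is_ideal0 (filt_ideal F k).
have Jp : J (Rees Fp).
  apply: (span_min idJ lJ); rewrite -lE => k /=; rewrite coefZ coefXn.
  by case: eqP => [->|_]; rewrite ?mulr1 // mulr0; apply: submod0.
have [|b Lb] := Jp n n 1 nD (leqnn n).
  by rewrite subnn filt0.
by rewrite mul1r /= coefZ coefXn eqxx mulr1 => ->; exists b.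
Qed.

Section SerreStep.
Variables (L N : family) (p : nat).
Hypotheses (gL : rees_submod L) (gN : rees_submod N) (NL : forall n v, N n v -> L n v).

(** The kernel of y_p on L/N, pulled back to L. *)
Definition colon_fam : family := fun n => [set v | L n v /\ N (n + 1) (y p * v)].
(** The preimage in L of the image of y_p on L/N. *)
Definition image_fam : family := fun n => [set u | exists v w, [/\ L (n - 1) v, N n w & u = y p * v + w]].

Lemma colon_fam_submod : rees_submod colon_fam.
Proof.
split=> [n|n u v [Lu Nu] [Lv Nv]|n v [Lv _]|k n a v Fa [Lv Nv]].
- by split; rewrite ?mulr0; apply: submod0.
- by split; rewrite ?mulrBr; apply: submodB.
- exact: (submodR gL).
- by split; [exact: submodM|rewrite mulrCA -addrA; apply: submodM].
Qed.

Lemma image_fam_submod : rees_submod image_fam.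
Proof.
split=> [n|n _ _ [u [w [Lu Nw ->]]] [v [x [Lv Nx ->]]]|n _ [u [w [Lu Nw ->]]]
    |k n a _ Fa [u [w [Lu Nw ->]]]].
- by exists 0, 0; split; rewrite ?mulr0 ?addr0 //; apply: submod0.
- exists (u - v), (w - x); split; [exact: submodB|exact: submodB|].
  by rewrite mulrBr opprD addrACA.
- apply: (submodR gL); apply: submodD => //; last exact: NL.
  by have := submodM gL (y1 p) Lu; rewrite addrC subrK.
- exists (a * u), (a * w); split; [|exact: submodM|by rewrite mulrDr mulrCA].
  by rewrite -addrA; apply: submodM.
Qed.

Lemma cochain_colon e s i m (c : koszul A^o s) :
  cochain L e i m c -> cochain N e i (m + 1) (y p *: c) -> cochain colon_fam e i m c.
Proof.
elim: s i m c => [|s IH] i m c /=; first by case: eqP.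
by move=> [/= ? ?] [/= ? ?]; split; apply: IH => //; rewrite addrAC.
Qed.

(** Multiplication by y_p on H^i(L/N) factors through the cohomology of its image,
image/N.  The first factor has kernel coming from H^i of the kernel of y_p, the
second one from H^(i-1) of L/image; both vanish here. *)
Lemma serre_kernel e i m (c : koszul A^o r) :
  vanishes y r 0 L image_fam (i - 1) (m + 1) -> vanishes y r 0 colon_fam N i m ->
  cochain L e i m c -> cochain N e (i + 1) m (kdiff y e c) ->
  cobounds y 0 L N e i (m + 1) (y p *: c) -> cobounds y 0 L N e i m c.
Proof.
move=> vI vK Lc Nc [e1 [b [le1 _ Lb Nb]]].
have [sL sN] := (submod_stable gL, submod_stable gN).
have [sK sI] := (submod_stable colon_fam_submod, submod_stable image_fam_submod).
have NI n v : N n v -> image_fam n v.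
  by move=> Nv; exists 0, v; split; rewrite ?mulr0 ?add0r //; apply: submod0.
have LI n v : L n v -> image_fam (n + 1) (y p *: (v : A^o)).
  move=> Lv; exists v, 0; split; rewrite ?addrK //; first exact: submod0.
  by rewrite addr0.
have [|e2 [b2 [le2 _ Lb2 Ib]]] := vI e1 b (frozen0 e1) Lb.
  rewrite subrK.
  have I1 : cochain image_fam e1 i (m + 1) (ktrans y e e1 (y p *: c)).
    by rewrite ktransZ; apply: (cochain_scale LI); apply: cochain_ktrans.
  have I2 := cochainB sI I1 (cochainS (fun n v _ => NI n v) Nb).
  by rewrite opprB [ktrans y e e1 _ + _]addrC subrK in I2.
(* a cochain in the image of y_p is y_p b4 up to N *)
have Ib' : cochain (fun n => image_fam (n + 1)) e2 (i - 1) m (ktrans y e1 e2 b - kdiff y e2 b2).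
  exact/cochain_shift.
have [||||b4 Lb4 Nw] := koszul_map_lift (phi := fun v : A^o => y p *: v) _ (L := L)
    (N' := fun n => N (n + 1)) _ _ _ Ib'.
- by move=> u v; apply: scalerBr.
- by move=> n; apply: submod0.
- by move=> n; apply: submod0.
- move=> n _ [v [w [Lv Nw ->]]]; exists v; first by move: Lv; rewrite addrK.
  by rewrite -[_ *: v]/(y p * v) [_ * _ + w]addrC addrK.
move/cochain_shift: Nw; rewrite koszul_map_scale => Nw.
have le12 := exp_le_trans le1 le2.
apply: (cobounds_ktrans le12); apply: (cobounds_add sL Lb4).
set c' := _ - _.
have Lc' : cochain L e2 i m c'.
  apply: (cochainB sL); first exact: cochain_ktrans.
  by rewrite -[i](subrK 1); apply: cochain_kdiff.
have Nc' : cochain N e2 i (m + 1) (y p *: c').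
  have := cochain_kdiff sN Nw; rewrite subrK => /(cochainD sN (cochain_ktrans sN le2 Nb)); congr cochain.
  rewrite !kdiffB kdiffK subr0 ktransB ktrans_ktrans // ktrans_kdiff // addrA subrK.
  by rewrite ktransZ kdiffZ scalerBr.
have [||e3 [b5 [le3 _ Lb5 Nb5]]] := vK e2 c' (frozen0 e2).
- exact: cochain_colon.
- by rewrite kdiffB kdiffK subr0 -ktrans_kdiff //; apply: cochain_ktrans.
by exists e3, b5; split=> //; apply: cochainS Lb5 => n v _ [].
Qed.

(** Every class is killed by y_p^(e_p), by [homotopyP], and y_p is injective in
degrees at least n0, by [serre_kernel]. *)
Lemma serre_step (i : int) (n0 : int) : (p < r)%N ->
  (forall n, n0 <= n -> vanishes y r 0 L image_fam (i - 1) n) ->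
  (forall n, n0 <= n -> vanishes y r 0 colon_fam N i n) ->
  forall n, n0 <= n -> vanishes y r 0 L N i n.
Proof.
move=> pr vI vK n nn0 e c _ Lc Nc.
have [sL sN] := (submod_stable gL, submod_stable gN).
suff H k : (k <= e p)%N -> cobounds y 0 L N e i (n + k%:Z) (y p ^+ k *: c).
  by have := H 0%N isT; rewrite addr0 expr0 scale1r.
move=> /subKn <-; elim: (e p - k)%N => [|l IH].
  rewrite subn0; exists e, (homotopy p c); split=> //; first exact: (homotopy_cochain sL).
  rewrite ktrans_id -(homotopyP y e c pr) addrAC subrr add0r.
  by have := homotopy_cochain sN pr Nc; rewrite addrK.
have [le|le] := leqP (e p) l.
  by rewrite (_ : e p - l.+1 = e p - l)%N //; lia.
move: IH; rewrite (_ : e p - l = (e p - l.+1).+1)%N; last by lia.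
set k' := (e p - l.+1)%N => IH.
apply: serre_kernel.
- by apply: vI; lia.
- by apply: vK; lia.
- exact: cochain_scaleX.
- by rewrite kdiffZ; apply: cochain_scaleX.
by move: IH; rewrite exprS -scalerA -addn1 PoszD addrA.
Qed.
End SerreStep.

(** Induction on the cohomological degree k - 1 and, inside, on the number of
the y_j that do not yet kill L/N.  When all of them do, L = N in high degrees by
[submod_fg]. *)
Theorem serre_vanishing (k : nat) L N : rees_submod L -> rees_submod N -> (forall n v, N n v -> L n v) ->
  exists n0 : nat, forall n : int, n0%:Z <= n -> vanishes y r 0 L N (k%:Z - 1) n.
Proof.
elim: k L N => [|k IHk] L N gL gN NL.
  by exists 0%N => n _; apply: van_neg => //; apply: submod_stable.
rewrite -addn1 PoszD addrK.
suff H q : (q <= r)%N -> forall L N, rees_submod L -> rees_submod N -> (forall n v, N n v -> L n v) ->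
   (forall j n v, (j < r - q)%N -> L n v -> N (n + 1) (y j * v)) ->
   exists n0 : nat, forall n : int, n0%:Z <= n -> vanishes y r 0 L N k%:Z n.
  by apply: (H r) => // j n v; rewrite subnn.
elim: q => [|q IHq] qr {}L {}N {}gL {}gN {}NL kill.
  have [n1 fg] := submod_fg gL.
  exists n1 => n nn1; apply: van_above; first exact: submod_stable.
  move=> m v nm Lv; have [|b Lb ->] := fg m v _ Lv; first exact: le_trans nm.
  apply: submod_sum => // j; have := kill j _ _ _ (Lb j); rewrite subrK subn0; apply.
  exact: ltn_ord.
pose p := (r - q.+1)%N.
have [|||n2 P2] := IHq (ltnW qr) (colon_fam L N p) N _ gN.
- exact: colon_fam_submod.
- move=> n v Nv; split; first exact: NL.
  by rewrite addrC; apply: (submodM gN (k := 1%N)).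
- move=> j n v jp [Lv Nv]; have [jp'|jp'] := ltnP j p; first exact: kill.
  by rewrite (_ : j = p) // /p; lia.
have [||n3 P3] := IHk L (image_fam L N p) gL.
- exact: image_fam_submod.
- move=> n _ [v [w [Lv Nw ->]]]; apply: submodD => //; last exact: NL.
  by have := submodM gL (y1 p) Lv; rewrite addrC subrK.
exists (maxn n2 n3); apply: (serre_step gL gN NL (p := p)).
- by rewrite /p; lia.
- by move=> m mm; apply: P3; apply: le_trans mm; rewrite lez_nat leq_maxr.
- by move=> m mm; apply: P2; apply: le_trans mm; rewrite lez_nat leq_maxl.
Qed.

End Families.

(** * The Rees algebra and the associated graded ring are Noetherian *)

Lemma noetherian_surj (B T : comNzRingType) (phi : {rmorphism B -> T}) :
  (forall t, exists b, phi b = t) -> noetherian B -> noetherian T.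
Proof.
move=> surj nB J idJ.
have [|s sE] := nB (phi @^-1` J).
  split=> [|a u v Ju Jv]; first by rewrite /= rmorph0; apply: is_ideal0.
  by rewrite /= rmorphD rmorphM; apply: idJ.2.
exists (map phi s); apply/seteqP; split.
  move=> t Jt; have [b bt] := surj t; have: (phi @^-1` J) b by rewrite /= bt.
  rewrite sE -bt; apply: (@span_min _ _ (phi @^-1` ideal_span [set` map phi s])).
    have idS := span_ideal [set` map phi s].
    split=> [|a u v Su Sv]; first by rewrite /= rmorph0; apply: is_ideal0.
    by rewrite /= rmorphD rmorphM; apply: idS.2.
  by move=> u us; apply: span_in; apply: map_f.
apply: span_min => // _ /mapP[u us ->].
by suff: (phi @^-1` J) u by []; rewrite sE; apply: span_in.
Qed.

Lemma span_sub (T : comNzRingType) (X Y : set T) : X `<=` Y -> ideal_span X `<=` ideal_span Y.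
Proof. by move=> XY; apply: span_min; [exact: span_ideal|move=> x /XY; apply: span_in]. Qed.

Section Hilbert.
Variables (B : comNzRingType) (J : set {poly B}).
Hypotheses (nB : noetherian B) (idJ : is_ideal J).

Let lc n : set B := [set c | exists p : {poly B}, [/\ J p, (size p <= n.+1)%N & p`_n = c]].

Let lc_ideal n : is_ideal (lc n).
Proof.
split; first by exists 0; rewrite size_poly0 coef0; split=> //; apply: is_ideal0.
move=> a _ _ [p [Jp sp <-]] [q [Jq sq <-]]; exists (a%:P * p + q); split.
- exact: idJ.2.
- rewrite mul_polyC; apply: leq_trans (size_polyD _ _) _.
  by rewrite geq_max sq andbT; apply: leq_trans (size_scale_leq _ _) sp.
- by rewrite coefD coefCM.
Qed.

Let lcS n k c : lc n c -> lc (n + k) c.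
Proof.
move=> [p [Jp sp <-]]; exists ('X^k * p); split.
- by apply: is_idealM.
- apply: leq_trans (size_polyMleq _ _) _; rewrite size_polyXn addSn /=.
  by rewrite addnC -addSn leq_add2r.
- by rewrite coefXnM ltnNge leq_addl /= addnK.
Qed.

Let lc_gen n : exists s : seq {poly B}, [set` s] `<=` J /\ forall c, lc n c ->
  exists q, [/\ ideal_span [set` s] q, (size q <= n.+1)%N & q`_n = c].
Proof.
have [l lE] := nB (lc_ideal n).
have [s [sJ ls]] : exists s : seq {poly B}, [set` s] `<=` J /\ forall c, c \in l ->
    exists q, [/\ q \in s, (size q <= n.+1)%N & q`_n = c].
  have: forall c, c \in l -> lc n c by move=> c cl; rewrite lE; apply: span_in.
  elim: l {lE} => [|c l IH] h; first by exists [::].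
  have [s [sJ ls]] := IH (fun u ul => h u (mem_behead (s := c :: l) ul)).
  have [p [Jp sp pc]] := h c (mem_head _ _).
  exists (p :: s); split=> [q|d]; first by rewrite /= inE => /orP[/eqP->|/sJ].
  rewrite inE => /orP[/eqP->|/ls[q [qs sq qd]]]; [exists p|exists q]; split=> //.
    exact: mem_head.
  by rewrite inE qs orbT.
exists s; split=> // c; rewrite lE; have idS := span_ideal [set` s].
apply: (@span_min _ _ [set c | exists q, [/\ ideal_span [set` s] q, (size q <= n.+1)%N & q`_n = c]]).
  split; first by exists 0; rewrite size_poly0 coef0; split=> //; apply: is_ideal0.
  move=> a _ _ [p [Jp sp <-]] [q [Jq sq <-]]; exists (a%:P * p + q); split.
  - exact: idS.2.
  - rewrite mul_polyC; apply: leq_trans (size_polyD _ _) _.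
    by rewrite geq_max sq andbT; apply: leq_trans (size_scale_leq _ _) sp.
  - by rewrite coefD coefCM.
by move=> d /ls[q [qs sq qd]]; exists q; split=> //; apply: span_in.
Qed.

(** The n-th ideal [lc n] collects the coefficients of degree n of elements of J
of degree at most n.  These ideals increase and stabilise at some N; lifts of
generators of those with n <= N generate J. *)
Lemma hilbert_ideal : exists s : seq {poly B}, J = ideal_span [set` s].
Proof.
have [N NP] : exists N, forall n c, lc n c -> lc N c.
  have [|l lE] := nB (I := [set c | exists n, lc n c]).
    split=> [|a u v [n nu] [m mv]]; first by exists 0%N; apply: is_ideal0 (lc_ideal 0).
    by exists (n + m)%N; apply: (lc_ideal _).2; [apply: lcS|rewrite addnC; apply: lcS].
  have [N NP] : exists N, forall c, c \in l -> lc N c.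
    have: forall c, c \in l -> exists n, lc n c.
      move=> c cl; suff: [set c | exists n, lc n c] c by [].
      by rewrite lE; apply: span_in.
    elim: l {lE} => [|c l IH] h; first by exists 0%N.
    have [N NP] := IH (fun u ul => h u (mem_behead (s := c :: l) ul)).
    have [n nc] := h c (mem_head _ _).
    exists (N + n)%N => d; rewrite inE => /orP[/eqP->|/NP]; last exact: lcS.
    by rewrite addnC; apply: lcS.
  exists N => n c nc; have: [set c | exists n, lc n c] c by exists n.
  by rewrite lE; apply: span_min.
have [s [sJ sP]] : exists s : seq {poly B}, [set` s] `<=` J /\ forall n c, (n <= N)%N ->
    lc n c -> exists q, [/\ ideal_span [set` s] q, (size q <= n.+1)%N & q`_n = c].
  elim: N {NP} => [|N [s [sJ sP]]].
    by have [s [sJ sP]] := lc_gen 0; exists s; split=> // -[|n] // c _; apply: sP.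
  have [t [tJ tP]] := lc_gen N.+1.
  exists (s ++ t); split=> [p|n c]; first by rewrite /= mem_cat => /orP[/sJ|/tJ].
  have st : [set` s] `<=` [set` s ++ t] by move=> p /= ps; rewrite mem_cat ps.
  have ts : [set` t] `<=` [set` s ++ t] by move=> p /= ps; rewrite mem_cat ps orbT.
  rewrite leq_eqVlt => /orP[/eqP->/tP|nN /(sP _ _ nN)] [q [sq qn qc]]; exists q; split=> //.
    exact: span_sub sq.
  exact: span_sub sq.
exists s; apply/seteqP; split; last exact: span_min.
have idS := span_ideal [set` s].
suff H n (p : {poly B}) : (size p <= n)%N -> J p -> ideal_span [set` s] p by move=> p; apply: H.
elim: n p => [|n IH] p.
  by rewrite leqn0 size_poly_eq0 => /eqP-> _; apply: is_ideal0.
move=> sp Jp.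
have [q [Sq sq qp]] : exists q, [/\ ideal_span [set` s] q, (size q <= n.+1)%N & q`_n = p`_n].
  have [nN|nN] := leqP n N; first by apply: sP => //; exists p.
  have [|q [Sq sq qp]] := sP N p`_n (leqnn N); first by apply: (NP n); exists p.
  exists ('X^(n - N) * q); split.
  - exact: (is_idealM idS).
  - apply: leq_trans (size_polyMleq _ _) _; rewrite size_polyXn addSn /=.
    by rewrite -[X in (_ <= X.+1)%N](subnK (ltnW nN)) -addnS leq_add2l.
  - by rewrite coefXnM ltnNge leq_subr /= subKn // ltnW.
rewrite -[p](subrK q); apply: (is_idealD idS) => //; apply: IH; last first.
  by apply: (is_idealB idJ) => //; apply: span_min Sq.
apply/leq_sizeP => j; rewrite leq_eqVlt => /orP[/eqP<-|nj].
  by rewrite coefB qp subrr.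
by rewrite coefB !nth_default ?subrr //; apply: leq_trans nj.
Qed.
End Hilbert.

Lemma hilbert_basis (B : comNzRingType) : noetherian B -> noetherian {poly B}.
Proof. by move=> nB J; apply: hilbert_ideal. Qed.

(** Adjoining finitely many elements, one polynomial variable at a time, keeps
the ring Noetherian. *)
Lemma noetherian_adjoin (B T : comNzRingType) (phi : {rmorphism B -> T}) (l : seq T) :
  noetherian B -> exists (B' : comNzRingType) (psi : {rmorphism B' -> T}),
  [/\ noetherian B', forall b, exists b', psi b' = phi b
    & forall t, t \in l -> exists b', psi b' = t].
Proof.
elim: l B phi => [|t l IH] B phi nB.
  by exists B, phi; split=> // b; exists b.
have cfu : commr_rmorph phi t by move=> b; apply: mulrC.
have [B' [psi [nB' h1 h2]]] := IH {poly B} (horner_morph cfu) (hilbert_basis nB).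
exists B', psi; split=> // [b|u].
  by have [b' b'E] := h1 b%:P; exists b'; rewrite b'E /= horner_morphC.
rewrite inE => /orP[/eqP->|/h2//].
by have [b' b'E] := h1 'X; exists b'; rewrite b'E /= horner_morphX.
Qed.

Section ReesNoetherian.
Variables (A : comNzRingType) (F : filtration A).

Lemma rees_constP (a : A) : a%:P \in rees_pred F.
Proof.
apply/rees_predP => -[|n]; rewrite coefC //=; first by rewrite filt0.
exact: is_ideal0 (filt_ideal F n.+1).
Qed.

Definition rees_const (a : A) : rees_type F := Rees (rees_constP a).

Lemma rees_const_additive : zmod_morphism rees_const.
Proof. by move=> a b; apply: val_inj; rewrite [RHS]rees_valB /= polyCB. Qed.

Lemma rees_const_monoid : monoid_morphism rees_const.
Proof. by split=> [|a b]; apply: val_inj; rewrite ?[RHS]rees_valM /= ?polyCM. Qed.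

HB.instance Definition _ := GRing.isZmodMorphism.Build A (rees_type F) rees_const rees_const_additive.
HB.instance Definition _ := GRing.isMonoidMorphism.Build A (rees_type F) rees_const rees_const_monoid.

Variables (y : nat -> A) (r K : nat).
Hypothesis y1 : forall j, F 1%N (y j).
Hypothesis ygen : forall n x, (K <= n)%N -> F n.+1 x ->
  exists2 b : nat -> A, (forall j, F n (b j)) & x = \sum_(j < r) y j * b j.

Lemma rees_monP n a : F n a -> a *: 'X^n \in rees_pred F.
Proof.
move=> Fa; apply/rees_predP => k; rewrite coefZ coefXn; case: eqP => [->|_].
  by rewrite mulr1.
by rewrite mulr0; apply: is_ideal0 (filt_ideal F k).
Qed.

(** As an algebra over A, the Rees algebra is generated by the generators of the
ideals I_n with n <= K + 1. *)
Lemma rees_noetherian : noetherian A -> noetherian (rees_type F).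
Proof.
move=> nA.
have gen n : exists l : seq (rees_type F), forall a, F n a ->
    ideal_span [set c | exists2 t, t \in l & rees_val t = c *: 'X^n] a.
  have [s sE] := nA (F n) (filt_ideal F n).
  have [l lP] : exists l : seq (rees_type F), forall c, c \in s ->
      exists2 t, t \in l & rees_val t = c *: 'X^n.
    have: forall c, c \in s -> F n c by move=> c cs; rewrite sE; apply: span_in.
    elim: s {sE} => [|c s IH] h; first by exists [::].
    have [l lP] := IH (fun u us => h u (mem_behead (s := c :: s) us)).
    exists (Rees (rees_monP (h c (mem_head _ _))) :: l) => d.
    rewrite inE => /orP[/eqP->|/lP[t tl td]]; first by eexists; first exact: mem_head.
    by exists t => //; rewrite inE tl orbT.
  by exists l => a; rewrite sE; apply: span_sub => c /lP.
have [l lP] : exists l : seq (rees_type F), forall n a, (n <= K.+1)%N -> F n a ->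
    ideal_span [set c | exists2 t, t \in l & rees_val t = c *: 'X^n] a.
  elim: K.+1 => [|M [l lP]].
    by have [l lP] := gen 0%N; exists l => -[|n] // a _; apply: lP.
  have [l' lP'] := gen M.+1; exists (l ++ l') => n a.
  rewrite leq_eqVlt => /orP[/eqP->/lP'|nM /(lP _ _ nM)]; apply: span_sub => c [t tl tc].
    by exists t => //; rewrite mem_cat tl orbT.
  by exists t => //; rewrite mem_cat tl.
have [B [psi [nB hc hl]]] := noetherian_adjoin rees_const l nA.
apply: (noetherian_surj (phi := psi) _ nB).
pose W n a := exists b, rees_val (psi b) = a *: 'X^n.
have W0 n : W n 0 by exists 0; rewrite rmorph0 rees_val0 scale0r.
have WD n u v : W n u -> W n v -> W n (u + v).
  by move=> [a au] [b bv]; exists (a + b); rewrite rmorphD rees_valD au bv scalerDl.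
have WM n m u v : W n u -> W m v -> W (n + m)%N (u * v).
  move=> [a au] [b bv]; exists (a * b); rewrite rmorphM rees_valM au bv.
  by rewrite -scalerAl -scalerAr scalerA exprD.
have WC c : W 0%N c.
  by have [b bc] := hc c; exists b; rewrite bc /= expr0 alg_polyC.
have WF n a : F n a -> W n a.
  elim: n a => [|n IH] a Fa; first exact: WC.
  have [nK|nK] := leqP K n.
    have [b Fb ->] := ygen nK Fa; apply: (big_ind (W n.+1)) => [|u v|j _]; [exact: W0|exact: WD|].
    rewrite -add1n; apply: (WM); last exact: IH.
    have := lP 1%N (y j) isT (y1 j); apply: (@span_min _ _ [set c | W 1%N c]).
      by split=> [|c u v Wu Wv]; [exact: W0|apply: (WD) => //]; rewrite -[1%N]add0n; apply: (WM).
    by move=> c [t /hl[b' b't] tc]; exists b'; rewrite b't.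
  have := lP n.+1 a (leqW nK) Fa; apply: (@span_min _ _ [set c | W n.+1 c]).
    by split=> [|c u v Wu Wv]; [exact: W0|apply: (WD) => //]; rewrite -[n.+1]add0n; apply: (WM).
  by move=> c [t /hl[b' b't] tc]; exists b'; rewrite b't.
move=> p.
have [b bp] : exists b, rees_val (psi b) = \sum_(i < size (rees_val p)) (rees_val p)`_i *: 'X^i.
  apply: (big_ind (fun q : {poly A} => exists b, rees_val (psi b) = q)) => [|u v [a <-] [b <-]|i _].
  - by exists 0; rewrite rmorph0 rees_val0.
  - by exists (a + b); rewrite rmorphD rees_valD.
  - by apply: WF; apply/rees_predP; case: (p).
by exists b; apply: val_inj; rewrite /= bp -poly_def coefK.
Qed.

Lemma assoc_noetherian : noetherian (rees_type F) -> noetherian (assoc_type F).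
Proof.
move=> nR.
pose phi : {rmorphism rees_type F -> assoc_type F} := (\pi_({ideal_quot (@assoc_ideal A F)}))%qT.
apply: (noetherian_surj (phi := phi) _ nR) => t; exact: assoc_pi_surj.
Qed.
End ReesNoetherian.

Lemma span_seqP (A : comNzRingType) (s : seq A) x : ideal_span [set` s] x ->
  exists c : nat -> A, x = \sum_(j < size s) c j * s`_j.
Proof.
apply: (@span_min _ _ [set x | exists c : nat -> A, x = \sum_(j < size s) c j * s`_j]).
  split=> [|a u v [c ->] [d ->]].
    by exists (fun=> 0); rewrite big1 // => j _; rewrite mul0r.
  exists (fun j => a * c j + d j); rewrite mulr_sumr -big_split /=.
  by apply: eq_bigr => j _; rewrite mulrDl mulrA.
move=> t ts; have ht : (index t s < size s)%N by rewrite index_mem.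
exists (fun j => (j == index t s)%:R).
rewrite (bigD1 (Ordinal ht)) //= eqxx mul1r nth_index // big1 ?addr0 // => k kj.
by rewrite (_ : (_ == _) = false) ?mul0r //; apply/negbTE; apply: contra kj => /eqP kj; apply/eqP/val_inj.
Qed.

(** Generators of the ideal I with I I_n = I_(n+1) for large n; they are
elements of I_1 because I = I I_0. *)
Lemma good_filtration_gen (A : comNzRingType) (F : filtration A) :
  noetherian A -> good_filtration F ->
  exists (y : nat -> A) (r K : nat), (forall j, F 1%N (y j)) /\
    forall n x, (K <= n)%N -> F n.+1 x ->
    exists2 b : nat -> A, (forall j, F n (b j)) & x = \sum_(j < r) y j * b j.
Proof.
move=> nA [I [idI IF [K KP]]]; have [s sE] := nA I idI.
exists (fun j => s`_j), (size s), K; split=> [j|n x Kn].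
  have [js|js] := ltnP j (size s); last first.
    by rewrite nth_default //; apply: is_ideal0 (filt_ideal F 1).
  apply: (IF 0%N); apply: span_in; exists s`_j, 1; rewrite mulr1 filt0; split=> //.
  by rewrite sE; apply: span_in; apply: mem_nth.
rewrite KP //; have idF := filt_ideal F n.
apply: (@span_min _ _ [set x | exists2 b : nat -> A, (forall j, F n (b j))
    & x = \sum_(j < size s) s`_j * b j]).
  split=> [|a u v [b Fb ->] [c Fc ->]].
    exists (fun=> 0) => [j|]; first exact: is_ideal0.
    by rewrite big1 // => j _; rewrite mulr0.
  exists (fun j => a * b j + c j) => [j|]; first exact: idF.2.
  rewrite mulr_sumr -big_split /=.
  by apply: eq_bigr => j _; rewrite mulrDr mulrCA.
move=> _ [u [v [Iu Fv ->]]]; move: Iu; rewrite sE => /span_seqP[c ->].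
exists (fun j => c j * v) => [j|]; first exact: is_idealM.
by rewrite mulr_suml; apply: eq_bigr => j _; rewrite mulrCA mulrA.
Qed.

(** * The two exact sequences *)

Section RegularityA.
Variables (A : comNzRingType) (F : filtration A) (y : nat -> A) (r K : nat).
Hypothesis nR : noetherian (rees_type F).
Hypothesis y1 : forall j, F 1%N (y j).
Hypothesis ygen : forall n x, (K <= n)%N -> F n.+1 x ->
  exists2 b : nat -> A, (forall j, F n (b j)) & x = \sum_(j < r) y j * b j.

Notation R := (rees_fam F).
Notation O := (@zero_fam A A^o).

Definition plus_fam : int -> set A^o :=
  fun n => if n is Posz k.+1 then F k.+1 : set A else [set 0].
(** The kernel J of R -> G is R_+ shifted by one. *)
Definition shift_fam (n : int) := plus_fam (n + 1).

Lemma plus_fam_sub n v : plus_fam n v -> R n v.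
Proof. by case: n => [[|n]|n] //= ->; apply: is_ideal0 (filt_ideal F 0). Qed.

Lemma shift_fam_sub n v : shift_fam n v -> R n v.
Proof.
rewrite /shift_fam; case: n => [n|[|n]].
- by rewrite (_ : n%:Z + 1 = n.+1%:Z); [apply: filtS|lia].
- by rewrite (_ : Negz 0 + 1 = 0).
by rewrite (_ : Negz n.+1 + 1 = Negz n) //; lia.
Qed.

Lemma plus_fam_eq n v : n != 0 -> R n v -> plus_fam n v.
Proof. by case: n => [[|n]|n]. Qed.

Lemma plus_fam_submod : rees_submod F plus_fam.
Proof.
have gR := rees_fam_submod F.
split=> [n|n u v|n v|k n a v Fa Pv].
- by case: n => [[|n]|n] //=; apply: is_ideal0 (filt_ideal F _).
- case: n => [[|n]|n] /=; rewrite ?subr0; try by move=> -> ->; rewrite subr0.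
  exact: (is_idealB (filt_ideal F _)).
- exact: plus_fam_sub.
have [n0|n0] := boolP (0 < n).
  by apply: plus_fam_eq; [lia|apply: (submodM gR) => //; apply: plus_fam_sub].
have v0 : v = 0 by move: n0 Pv; case: n => [[|n]|n].
rewrite v0 mulr0; case: (_ + n) => [[|m]|m] //=; exact: is_ideal0 (filt_ideal F _).
Qed.

Lemma stable_rees_fam : stable y R. Proof. exact: submod_stable (rees_fam_submod F). Qed.
Lemma stable_plus_fam : stable y plus_fam. Proof. exact: submod_stable plus_fam_submod. Qed.
Lemma stable_shift_fam : stable y shift_fam.
Proof.
have [P0 PB PY] := stable_plus_fam; split=> [n|n u v|n j v]; [exact: P0|exact: PB|].
by move=> Jv; apply: PY.
Qed.
Lemma stable_zero_fam_A : stable y O. Proof. exact: stable_zero_fam. Qed.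

(** In positive cohomological degree the transition map multiplies by some y_j,
which kills R/R_+. *)
Lemma ktrans_plus e s i n (c : koszul A^o s) : i != 0 -> cochain R e i n c ->
  cochain plus_fam (fun j => (e j).+1) i n (ktrans y e (fun j => (e j).+1) c).
Proof.
elim: s i n c => [|s IH] i n c i0 /=; first by rewrite (negPf i0).
move=> [La Lb]; split; first exact: IH.
rewrite subSnn expr1 -addn1 PoszD addrA; apply: (@cochain_scale _ _ R).
  move=> m v Rv; have := submodM (rees_fam_submod F) (y1 s) Rv; rewrite addrC.
  case: m Rv => [m|[|m]] Rv.
  - by rewrite (_ : m%:Z + 1 = m.+1%:Z) //; lia.
  - by rewrite (Rv : v = 0) [_ *: _]mulr0 => _; case: stable_plus_fam.
  - by rewrite (Rv : v = 0) [_ *: _]mulr0 => _; case: stable_plus_fam.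
by apply: (cochain_ktrans stable_rees_fam).
Qed.

(** R/R_+ = A is torsion and concentrated in degree 0, so its only cohomology is
A in bidegree (0, 0). *)
Lemma van_degree0 i n : i != 0 \/ n != 0 -> vanishes y r 0 R plus_fam i n.
Proof.
move=> h e c _ Rc _; have [i0|i0] := eqVneq i 0.
  have n0 : n != 0 by case: h => //; rewrite i0.
  subst i; have [v Rv ->] := cochain_bottomP Rc.
  apply: cobounds0 => //; first exact: stable_rees_fam.
  by apply: (cochain_bottom _ _ stable_plus_fam); apply: plus_fam_eq.
exists (fun j => (e j).+1), 0; split=> //.
- exact: (cochain0 _ _ _ _ stable_rees_fam).
- by rewrite kdiff0 subr0; apply: ktrans_plus.
Qed.

Lemma van_shift_fam i n : vanishes y r 0 shift_fam O i n <-> vanishes y r 0 plus_fam O i (n + 1).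
Proof. exact: (van_shift y r 0 plus_fam O). Qed.

Let OP n v : O n v -> plus_fam n v. Proof. by move=> ->; case: stable_plus_fam. Qed.
Let OJ n v : O n v -> shift_fam n v. Proof. by move=> ->; case: stable_shift_fam. Qed.

Lemma van_plus i n : i != 1 \/ n != 0 -> vanishes y r 0 R O i n -> vanishes y r 0 plus_fam O i n.
Proof.
move=> h v; apply: (van_sub stable_zero_fam_A stable_plus_fam OP plus_fam_sub) => //.
by apply: van_degree0; case: h => h; [left|right] => //; lia.
Qed.

Lemma van_neg_degree f N' i n : stable y N' ->
  i <= 0 -> n < 0 -> vanishes y r f R N' i n.
Proof.
move=> sN i0 n0 e c fr Rc Nc.
apply: cobounds0 => //; first exact: stable_rees_fam.
have [i1|i1] := boolP (i < 0); first by rewrite (cochain_neg i1 Rc); apply: cochain0 sN.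
have ie : i = 0 by lia.
subst i; have [v Rv ->] := cochain_bottomP Rc.
have -> : v = 0 by move: Rv n0; case: n {Rc Nc}.
by rewrite bottom0; apply: cochain0 sN.
Qed.

(** The two inequalities between the regularities; [shift_fam] stands for J, so
the two modules are the Rees algebra and the associated graded ring. *)
Theorem regularity_criteria (c : int) :
  (forall i n, c < n + i -> vanishes y r 0 R O i n) <->
  (forall i n, c < n + i -> vanishes y r 0 R shift_fam i n).
Proof.
split=> H i n cn.
  have [i0|i0] := boolP ((i <= 0) && (n < 0)).
    by case/andP: i0 => *; apply: van_neg_degree => //; exact: stable_shift_fam.
  apply: (van_quo stable_zero_fam_A stable_shift_fam stable_rees_fam OJ shift_fam_sub); first exact: H.
  by apply/van_shift_fam; apply: van_plus; [lia|apply: H; lia].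
(* for c < 0 the case i = 1, m = -1 below would meet H^0(A) *)
have c0 : 0 <= c.
  rewrite leNgt; apply/negP => c0.
  have JF : forall v, R 0 v -> shift_fam 0 v.
    move=> v; apply: (regularity_nonneg (y := y) (r := r) stable_rees_fam stable_shift_fam); first by [].
    by move=> i' n' ni; apply: H; lia.
  apply: (@filt1 _ F); apply/seteqP; split=> // v _; apply: (JF v).
  by rewrite /= filt0.
have [i0|i0] := boolP (i < 0); first by apply: van_neg => //; [exact: stable_rees_fam|exact: stable_zero_fam_A].
have [k ik] : exists k : nat, i = k%:Z by exists `|i|%N; lia.
have [n0 n0P] := serre_vanishing nR y1 ygen k.+1 (rees_fam_submod F) (zero_fam_submod F)
  (fun n v (h : O n v) => plus_fam_sub (OP h)).
have {}n0P m : n0%:Z <= m -> vanishes y r 0 R O i m.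
  by move=> /n0P; rewrite (_ : k.+1%:Z - 1 = i) // ik; lia.
(* descending induction on n, started by Serre vanishing *)
suff D d : forall n, c < n + i -> n0%:Z <= n + d%:Z -> vanishes y r 0 R O i n.
  by apply: (D (`|n| + n0)%N) => //; lia.
elim: d => [|d IH] m cm nm; first by apply: n0P; lia.
apply: (van_ext stable_zero_fam_A stable_rees_fam OJ shift_fam_sub); last exact: H.
by apply/van_shift_fam; apply: van_plus; [lia|apply: IH; lia].
Qed.
End RegularityA.

(** * From families of ideals back to the graded rings *)

Section Bridge.
Variables (A : comNzRingType) (F : filtration A) (y : nat -> A) (r K : nat).
Hypothesis nA : noetherian A.
Hypothesis y1 : forall j, F 1%N (y j).
Hypothesis ygen : forall n x, (K <= n)%N -> F n.+1 x ->
  exists2 b : nat -> A, (forall j, F n (b j)) & x = \sum_(j < r) y j * b j.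

Lemma rees_monP1 j : y j *: 'X \in rees_pred F.
Proof. by rewrite -['X]expr1; apply: rees_monP. Qed.

Definition rees_y j : rees F := Rees (rees_monP1 j).
Definition assoc_y j : assoc_graded F := assoc_pi (rees_y j).

Lemma rees_y1 j : gr_piece 1 (rees_y j).
Proof.
move=> k k1 /=; rewrite coefZ coefX.
have /negPf-> : (k != 1)%N by apply: contra k1 => /eqP->.
by rewrite mulr0.
Qed.

Lemma assoc_y1 j : gr_piece 1 (assoc_y j).
Proof. by exists (rees_y j) => //; apply: rees_y1. Qed.

Lemma rees_gen (n : int) x : K%:Z < n -> rees_piece n x ->
  exists g : nat -> rees F, x = \sum_(j < r) rees_y j * g j.
Proof.
case: n => [[|n]|n] // Kn nx; have {}Kn : (K <= n)%N by lia.
have Fx : F n.+1 (rees_val x)`_n.+1 by apply/rees_predP; case: (x).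
have [b Fb xb] := ygen Kn Fx.
exists (fun j => Rees (rees_monP (Fb j))); apply: val_inj.
rewrite (rmorph_sum val) /=; apply/polyP => k; rewrite coef_sum.
under eq_bigr do rewrite -scalerAl -scalerAr -exprS scalerA coefZ coefXn.
rewrite -mulr_suml -xb.
case: eqP => [->|/eqP kn]; first by rewrite mulr1.
by rewrite mulr0; apply: nx; rewrite eqz_nat.
Qed.

Lemma assoc_gen (n : int) x : K%:Z < n -> assoc_piece n x ->
  exists g : nat -> assoc_graded F, x = \sum_(j < r) assoc_y j * g j.
Proof.
move=> Kn [p np <-]; have [g ->] := rees_gen Kn np.
exists (fun j => assoc_pi (g j)); rewrite assoc_pi_sum.
by apply: eq_bigr => j _; rewrite assoc_piM.
Qed.

(** Evaluation at t = 1 identifies each homogeneous piece of the Rees algebra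
with an ideal of A. *)
Definition eval1 (p : rees F) : A^o := (rees_val p).[1].

Lemma eval1B : {morph eval1 : u v / u - v}.
Proof. by move=> u v; rewrite /eval1 rees_valB hornerD hornerN. Qed.

Lemma eval1_0 : eval1 0 = 0.
Proof. by rewrite -[X in eval1 X](subrr 0) eval1B subrr. Qed.

Lemma eval1Y j (v : self_module (rees F)) : eval1 (rees_y j *: v) = y j *: eval1 v.
Proof. by rewrite /eval1 [rees_val _]rees_valM hornerM hornerZ hornerX mulr1. Qed.

Lemma rees_piece_mon (n : int) (p : rees_type F) : rees_piece n p ->
  rees_val p = if n is Posz k then (rees_val p)`_k *: 'X^k else 0.
Proof.
move=> np; apply/polyP => k; case: n np => [n|n] np; last by rewrite coef0 np.
rewrite coefZ coefXn; case: eqP => [->|/eqP kn]; first by rewrite mulr1.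
by rewrite mulr0 np.
Qed.

Lemma eval1_piece (n : int) (p : rees_type F) : rees_piece n p ->
  eval1 p = if n is Posz k then (rees_val p)`_k else 0.
Proof.
move=> /rees_piece_mon; rewrite /eval1 => ->; case: n => [n|n]; last by rewrite horner0.
by rewrite hornerZ hornerXn expr1n mulr1 coefZ coefXn eqxx mulr1.
Qed.

Lemma eval1_rees (n : int) p : rees_piece n p -> rees_fam F n (eval1 p).
Proof.
move=> np; rewrite (eval1_piece np); case: n np => //= n _.
by apply/rees_predP; case: (p).
Qed.

Lemma eval1_lift (n : int) w : rees_fam F n w -> exists2 p, rees_piece n p & eval1 p = w.
Proof.
case: n => [n|n] /= Fw; last first.
  exists (0 : rees_type F); first by move=> k _; rewrite [\val _]rees_val0 coef0.
  by rewrite [LHS]eval1_0 Fw.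
have np : rees_piece n%:Z (Rees (rees_monP Fw)).
  move=> k; rewrite eqz_nat /= coefZ coefXn => /negPf->.
  by rewrite mulr0.
exists (Rees (rees_monP Fw)) => //.
by rewrite (eval1_piece np) /= coefZ coefXn eqxx mulr1.
Qed.

Lemma van_rees i n :
  vanishes rees_y r 0 (@gm_piece _ (self_module (rees F))) (@zero_fam _ _) i n <->
  vanishes y r 0 (rees_fam F) (@zero_fam A A^o) i n.
Proof.
apply: (van_transport (V := self_module (rees F)) (W := A^o) (phi := eval1)).
- exact: eval1B.
- exact: eval1Y.
- exact: gm_stable rees_y1 _.
- exact: stable_zero_fam.
- exact: eval1_rees.
- move=> m p mp; rewrite /zero_fam /=; split=> [->|].
    exact: eval1_0.
  rewrite (eval1_piece mp) => p0.
  suff : rees_val p = rees_val (0 : rees_type F) by apply: val_inj.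
  rewrite rees_val0 (rees_piece_mon mp); case: m p0 {mp} => // k ->; exact: scale0r.
- by move=> m w /eval1_lift[p mp <-]; exists p => //; apply: subrr.
- by move=> m w ->; apply: (gP0 (rees_grading F)).
Qed.

Definition rees_ideal_fam (n : int) : set (self_module (rees F)) :=
  [set p : rees_type F | rees_piece n p /\ p \in @assoc_ideal A F].

Lemma van_rees_ideal i n :
  vanishes rees_y r 0 (@gm_piece _ (self_module (rees F))) rees_ideal_fam i n <->
  vanishes y r 0 (rees_fam F) (shift_fam F) i n.
Proof.
apply: (van_transport (V := self_module (rees F)) (W := A^o) (phi := eval1)).
- exact: eval1B.
- exact: eval1Y.
- exact: gm_stable rees_y1 _.
- exact: stable_shift_fam.
- exact: eval1_rees.
- move=> m p mp; rewrite (eval1_piece mp); split=> [[_ /assoc_idealP Jp]|Jp].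
    case: m mp => [k|k] _; last by case: (stable_shift_fam y1).
    by rewrite /shift_fam (_ : k%:Z + 1 = k.+1%:Z); [exact: Jp|lia].
  split=> //; apply/assoc_idealP => k; rewrite [val p](rees_piece_mon mp).
  case: m mp Jp => [l|l] mp; last by rewrite coef0 => _; apply: is_ideal0 (filt_ideal F _).
  rewrite coefZ coefXn; case: eqP => [->|_ _]; last first.
    by rewrite mulr0; apply: is_ideal0 (filt_ideal F _).
  by rewrite mulr1 /shift_fam (_ : l%:Z + 1 = l.+1%:Z) //; lia.
- move=> m w /eval1_lift[p mp <-]; exists p => //; rewrite subrr; by case: (stable_shift_fam y1).
- by move=> m w [].
Qed.

Lemma van_assoc i n :
  vanishes assoc_y r 0 (@gm_piece _ (self_module (assoc_graded F))) (@zero_fam _ _) i n <->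
  vanishes rees_y r 0 (@gm_piece _ (self_module (rees F))) rees_ideal_fam i n.
Proof.
symmetry; apply: (van_transport (phi := @assoc_pi A F : self_module (rees F) -> self_module (assoc_graded F))).
- exact: assoc_piB.
- by move=> j v; apply: assoc_piM.
- exact: gm_stable rees_y1 _.
- exact: stable_zero_fam.
- by move=> m p mp; exists p.
- move=> m p mp; split=> [[_ /assoc_pi_eq0]//|/assoc_pi_eq0 Jp]; by split.
- by move=> m w [p mp <-]; exists p => //; apply: subrr.
- by move=> m w [].
Qed.

Lemma lc_bound_iff (ER : graded_injective_resolution (self_module (rees F)))
  (EG : graded_injective_resolution (self_module (assoc_graded F))) (c : int) :
  (forall (i : nat) n, lc_nonzero ER i n -> n + i%:Z <= c) <->
  (forall (i : nat) n, lc_nonzero EG i n -> n + i%:Z <= c).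
Proof.
have nR := rees_noetherian y1 ygen nA; have nG := assoc_noetherian nR.
have vR i n : ~ lc_nonzero ER i n <-> vanishes y r 0 (rees_fam F) (@zero_fam A A^o) i%:Z n.
  rewrite -van_rees; apply: local_cohomology_koszul => //; first exact: rees_y1.
  exact: torsionP rees_y1 rees_gen.
have vG i n : ~ lc_nonzero EG i n <-> vanishes y r 0 (rees_fam F) (shift_fam F) i%:Z n.
  rewrite -van_rees_ideal -van_assoc; apply: local_cohomology_koszul => //; first exact: assoc_y1.
  exact: torsionP assoc_y1 assoc_gen.
have H (E : nat -> int -> Prop) (N : int -> set A^o) : stable y N ->
    (forall i n, ~ E i n <-> vanishes y r 0 (rees_fam F) N i%:Z n) ->
    (forall (i : nat) n, E i n -> n + i%:Z <= c) <->
    (forall i n, c < n + i -> vanishes y r 0 (rees_fam F) N i n).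
  move=> sN EN; split=> [h i n cn|h i n Ein].
    case: i cn => i cn; last by apply: van_neg => //; exact: stable_rees_fam.
    by apply/EN => /h; rewrite leNgt cn.
  by rewrite leNgt; apply/negP => cn; have /EN := h i%:Z n cn; apply.
rewrite (H _ _ (@stable_zero_fam A A^o y) vR) (H _ _ (stable_shift_fam y1) vG).
exact: (regularity_criteria nR y1 ygen).
Qed.
End Bridge.

(** * Suprema of extended integers *)

Lemma int_set_min (U : set int) (b : int) : U !=set0 -> (forall u, U u -> b <= u) ->
  exists2 m, U m & forall u, U u -> m <= u.
Proof.
move=> [u0 Uu0] bU.
have ex : exists n : nat, `[< U (b + n%:Z) >].
  by exists `|u0 - b|%N; apply/asboolP; have bu := bU _ Uu0; rewrite (_ : b + _ = u0) //; lia.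
case: (ex_minnP ex) => n /asboolP Un nmin; exists (b + n%:Z) => // u Uu.
have ub := bU _ Uu; have := nmin `|u - b|%N.
rewrite (_ : b + `|u - b|%N%:Z = u); last by lia.
by move=> /(_ (asboolT Uu)); lia.
Qed.

Local Open Scope ereal_scope.

(** Every set of extended integers has a supremum: either it has no integer
upper bound, or these have a minimum, or all integers are upper bounds. *)
Lemma ereal_int_sup (X : set (\bar int)) : supremums X !=set0.
Proof.
pose U := [set c : int | ubound X c%:E].
have [U0|U0] := pselect (U !=set0); last first.
  exists +oo; split=> [x _|[c|//|] ub]; first exact: leey.
    by case: U0; exists c.
  case: U0; exists 0%R.
  by move=> x /ub; rewrite leeNy_eq => /eqP->; apply: leNye.
have [[b bU]|nb] := pselect (exists b : int, forall u, U u -> (b <= u)%R).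
  have [m Um mmin] := int_set_min U0 bU.
  exists m%:E; split=> // -[c|_|ub]; [by move=> /mmin; rewrite lee_fin|exact: leey|].
  have : U (m - 1)%R by move=> x /ub; rewrite leeNy_eq => /eqP->; apply: leNye.
  by move=> /mmin; lia.
exists -oo; split=> [x Xx|x _]; last exact: leNye.
have lowU (c : int) : exists2 u, U u & (u < c)%R.
  apply: contrapT => h; apply: nb; exists c => u Uu; rewrite leNgt; apply/negP => uc.
  by apply: h; exists u.
case: x Xx => [s||] Xs //.
  by have [u /(_ _ Xs)] := lowU s; rewrite lee_fin => us us'; lia.
by have [u /(_ _ Xs)] := lowU 0%R.
Qed.

Lemma supremum_le (X : set (\bar int)) (c : int) :
  supremum -oo X <= c%:E <-> forall x, X x -> x <= c%:E.
Proof.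
split=> [h x Xx|h].
  by apply: le_trans h; apply: ge_supremum_Nmem => //; apply: ereal_int_sup.
rewrite /supremum; case: ifPn => _; first exact: leNye.
by case: (xgetPex -oo (ereal_int_sup X)) => _; apply.
Qed.

(** Regularities are compared through their integer upper bounds, which determine
an extended integer by [ereal_int_eq]. *)
Lemma reg_le (S : gradedRing) (M : gradedModule S) (E : graded_injective_resolution M)
  (c : int) :
  reg E <= c%:E <-> forall (i : nat) n, lc_nonzero E i n -> (n + i%:Z <= c)%R.
Proof.
rewrite supremum_le; split=> h.
  move=> i n Ein; have /h : [set a_inv E i + (i%:Z)%:E | i in [set: nat]] (a_inv E i + (i%:Z)%:E).
    by exists i.
  rewrite -leeBrDr //= -EFinB => /supremum_le/(_ n%:E); rewrite lee_fin lerBrDr.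
  by apply; exists n.
move=> _ [i _ <-]; rewrite -leeBrDr //= -EFinB; apply/supremum_le => _ [n Ein <-].
by rewrite lee_fin lerBrDr; apply: h.
Qed.

Lemma ereal_int_eq (x z : \bar int) : (forall c : int, x <= c%:E <-> z <= c%:E) -> x = z.
Proof.
have up (x' z' : \bar int) : (forall c : int, x' <= c%:E <-> z' <= c%:E) -> z' <= x'.
  move=> h; case: x' h => [c||] h; [exact/h|exact: leey|].
  case: z' h => [d||] h //.
    by have := (h (d - 1)%R).1 (leNye _); rewrite lee_fin; lia.
  by have := (h 0%R).1 (leNye _).
by move=> h; apply/eqP; rewrite eq_le !up // => c; split=> /h.
Qed.
Local Close Scope ereal_scope.

Theorem corollary3p4 (A : comNzRingType) (hN : noetherian A)
  (hL : local_ring A) (F : filtration A) (hF : good_filtration F)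
  (ER : graded_injective_resolution (self_module (rees F)))
  (EG : graded_injective_resolution (self_module (assoc_graded F))) :
  reg ER = reg EG.
Proof.
have [y [r [K [y1 ygen]]]] := good_filtration_gen hN hF.
by apply: ereal_int_eq => c; rewrite !reg_le; apply: (lc_bound_iff hN y1 ygen).
Qed.
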